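(* Let $B=B(0,1)\subset\mathbb{R}^N$ ($N\ge2$) be the unit ball, let $\rho:[0,1]\to\mathbb{R}$ be a smooth function such that $c(x)=-x\rho(|x|)$, $x\in B$, is a smooth vector field, and for $A\ge 0$ consider the problem $$-\Delta u-A\rho(|x|)\,x\cdot\nabla u=\lambda f(u)\ \text{ in }B,\qquad u=0\ \text{ on }\partial B,$$ with extremal parameter $\lambda^*(A)$, where $f$ is a regular or singular nonlinearity. Let $L_A=-\Delta-A\rho(|x|)\,x\cdot\nabla$, and let $\psi_{L_A,B}$ be the supremum over $B$ of the torsion function of $L_A$. Then: (i) If there exists $x_0\in[0,1]$ such that $\rho(x_0)<0$, then $\psi_{L_A,B}\to\infty$ as $A\to\infty$. Consequently, for every nonlinearity $f$, $\lambda^*(A)\to0$ as $A\to\infty$. (ii) If $\rho\ge0$ and $\rho\not\equiv0$ on any nondegenerate interval $I\subseteq[0,1]$, then $\psi_{L_A,B}\to0$ as $A\to\infty$. Consequently, for every nonlinearity $f$, $\lambda^*(A)\to\infty$ as $A\to\infty$. (iii) If $\rho\ge0$ and $\rho\equiv0$ on some nondegenerate interval $I\subseteq[0,1]$, then there exists a positive constant $C_{N,\rho}$, depending on $\rho$ and $N$ and independent of $A$, such that $$C_{N,\rho}\le\psi_{L_A,B}\le\frac{1}{2N}\quad\text{for all }A\ge0.$$ Consequently, for every nonlinearity $f$ there exist positive constants $D_{N,f}$ (depending on $N$ and $f$ but not on $A$) and $\tilde D_{N,\rho,f}$ (depending on $\rho$, $N$ and $f$ but not on $A$) such that $D_{N,f}\le\lambda^*(A)\le\tilde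 D_{N,\rho,f}$ for all $A\ge0$.
   Context: Nonlinearities: $f:[0,a_f)\to\mathbb{R}_+$ is smooth, increasing and convex, with $f(0)>0$ and $\int_0^{a_f}\frac{ds}{f(s)}<\infty$. It is regular if $a_f=+\infty$ and $f(t)/t\to\infty$ as $t\to\infty$, and singular if $a_f=1$ and $\lim_{t\nearrow1}f(t)=+\infty$. The torsion function $\psi_{L_A}$ is the unique nonnegative smooth solution of $L_A\psi=1$ in $B$, $\psi=0$ on $\partial B$, and $\psi_{L_A,B}=\sup_B\psi_{L_A}$. A solution $u$ is classical if $\|u\|_{L^\infty}<\infty$ (regular $f$) or $\|u\|_{L^\infty}<1$ (singular $f$). The extremal parameter $\lambda^*(A)\in(0,\infty)$ is the number such that the problem has a nonnegative classical solution for $0<\lambda<\lambda^*(A)$ and has no classical solution for $\lambda>\lambda^*(A)$. *)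

(* Defs.v *)
From HB Require Import structures.
From mathcomp Require Import all_boot all_order all_algebra.
From mathcomp Require Import all_classical all_reals all_analysis.

Set Implicit Arguments.
Unset Strict Implicit.
Unset Printing Implicit Defensive.

Import Order.TTheory GRing.Theory Num.Theory.
Import numFieldNormedType.Exports.

Local Open Scope classical_set_scope.
Local Open Scope ring_scope.

Section Smoothness.
Context {R : realType} {V : normedModType R}.

Fixpoint iter_derive (vs : seq V) (f : V -> R) : V -> R :=
  if vs is v :: vs' then 'D_v (iter_derive vs' f) else f.

(* For finite-dimensional V and open U this is the usual class C^k(U): all
   directional derivatives of order at most k exist and are continuous. *)
Definition class_C (k : nat) (U : set V) (f : V -> R) : Prop :=
  forall (vs : seq V) (x : V), (size vs <= k)%N -> U x ->
    {for x, continuous (iter_derive vs f)} /\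
    ((size vs < k)%N -> forall v, derivable (iter_derive vs f) x v).

Definition smooth (U : set V) (f : V -> R) : Prop := forall k, class_C k U f.

(* On a set D that need not be open (such as [0, 1] or [0, a[), smooth means
   being the restriction of a smooth function on an open set containing D. *)
Definition smooth_on (D : set V) (f : V -> R) : Prop :=
  exists (U : set V) (g : V -> R),
    [/\ open U, D `<=` U, smooth U g & {in D, f =1 g}].

End Smoothness.

Section Ball.
Context {R : realType} {N : nat}.
Implicit Types (x y : 'rV[R]_N) (u : 'rV[R]_N -> R).

Definition dot x y : R := \sum_(i < N) x ord0 i * y ord0 i.

(* The library norm on 'rV[R]_N is the maximum norm. *)
Definition enorm x : R := Num.sqrt (dot x x).

Definition unit_ball : set 'rV[R]_N := [set x | enorm x < 1].
Definition closed_unit_ball : set 'rV[R]_N := [set x | enorm x <= 1].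
Definition unit_sphere : set 'rV[R]_N := [set x | enorm x = 1].

Definition partial (i : 'I_N) u : 'rV[R]_N -> R := 'D_(delta_mx ord0 i) u.

Definition grad u x : 'rV[R]_N := \row_(i < N) partial i u x.

Definition laplacian u x : R := \sum_(i < N) partial i (partial i u) x.

Definition Lop (rho : R -> R) (A : R) u x : R :=
  - laplacian u x - A * rho (enorm x) * dot x (grad u x).

Definition is_torsion (rho : R -> R) (A : R) u : Prop :=
  [/\ smooth unit_ball u,
      {within closed_unit_ball, continuous u},
      (forall x, closed_unit_ball x -> 0 <= u x),
      (forall x, unit_ball x -> Lop rho A u x = 1)
    & (forall x, unit_sphere x -> u x = 0)].

Definition sup_ball u : R := sup (u @` unit_ball).

(* For u continuous on the ball, this is its L^oo norm there. *)
Definition sup_norm u : \bar R := ereal_sup [set `|u x|%:E | x in unit_ball].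

(* The nonlinearity f has domain [0, a[, hence the requirement 0 <= u; the
   bound on the sup norm is "finite" for a = +oo and "less than 1" for a = 1. *)
Definition is_classical_solution (rho : R -> R) (A : R) (a : \bar R)
    (f : R -> R) (lambda : R) u : Prop :=
  [/\ class_C 2 unit_ball u,
      {within closed_unit_ball, continuous u},
      (forall x, closed_unit_ball x -> 0 <= u x),
      (sup_norm u < a)%E
    & (forall x, unit_ball x -> Lop rho A u x = lambda * f (u x)) /\
      (forall x, unit_sphere x -> u x = 0)].

End Ball.

Section Data.
Context {R : realType}.

Definition admissible_rho (N : nat) (rho : R -> R) : Prop :=
  smooth_on (V := R^o) `[0, 1] rho /\
  forall i : 'I_N,
    smooth unit_ball (fun x : 'rV[R]_N => (- rho (enorm x) *: x) ord0 i).

Definition nondegenerate_subinterval (I : set R) : Prop :=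
  [/\ is_interval I, I `<=` `[0, 1] & exists x y, [/\ I x, I y & x < y]].

Definition nldom (a : \bar R) : set R := [set t | 0 <= t /\ (t%:E < a)%E].

Definition regular (a : \bar R) (f : R -> R) : Prop :=
  a = +oo%E /\ f t / t @[t --> +oo] --> +oo.

Definition singular (a : \bar R) (f : R -> R) : Prop :=
  a = 1%:E /\ f t @[t --> 1^'-] --> +oo.

(* f is only meaningful on [0, a[. *)
Definition nonlinearity (a : \bar R) (f : R -> R) : Prop :=
  [/\ smooth_on (V := R^o) (nldom a) f,
      {in nldom a &, {homo f : s t / s < t}},
      convex_function (E := R^o) (nldom a) f,
      (forall t, nldom a t -> 0 <= f t) /\ 0 < f 0
    & (\int[lebesgue_measure]_(s in nldom a) ((f s)^-1)%:E < +oo)%E] /\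
  (regular a f \/ singular a f).

Definition is_extremal_parameter (N : nat) (rho : R -> R) (A : R)
    (a : \bar R) (f : R -> R) (lambdastar : R) : Prop :=
  [/\ 0 < lambdastar,
      (forall lambda, 0 < lambda < lambdastar ->
        exists u : 'rV[R]_N -> R, is_classical_solution rho A a f lambda u)
    & (forall lambda, lambdastar < lambda ->
        ~ exists u : 'rV[R]_N -> R, is_classical_solution rho A a f lambda u)].

End Data.

(* Main.v *)
Require Import Defs.
From HB Require Import structures.
From mathcomp Require Import all_boot all_order all_algebra.
From mathcomp Require Import all_classical all_reals all_analysis.
From mathcomp Require Import ring lra.

Set Implicit Arguments.
Unset Strict Implicit.
Unset Printing Implicit Defensive.

Import Order.TTheory GRing.Theory Num.Theory.
Import numFieldNormedType.Exports.

Local Open Scope classical_set_scope.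
Local Open Scope ring_scope.

(** Everything rests on comparing functions on the ball at a point where one
    touches the other. There the gradients agree, so the drift terms cancel
    and only the signs of second derivatives matter ([Lop_le_of_touch]).
    Arbitrary torsion functions and solutions of the nonlinear problem can
    thus be compared with explicit radial sub- and supersolutions.

    Lower bounds for the torsion function and upper bounds for the extremal
    parameter come from one barrier: a decreasing radial function equal to [K]
    inside radius [al], to 0 outside radius [be], and to a rescaled quintic
    step in between. If [rho] is negative between [al] and [be], a strong
    drift makes the barrier a subsolution for arbitrarily large [K]; if [rho]
    vanishes there, it is a subsolution for a fixed [K] and all [A]
    ([barrier_Lop_le] and the two estimates after it). A multiple of the
    barrier touching the torsion function from below bounds the latter
    ([torsion_ge_barrier]). The same argument applied to a solution, combined
    with [c * t <= f t], bounds [lambda] by an eigenvalue-type constant of the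
    barrier ([classical_parameter_le]).

    The opposite bounds concern nonnegative [rho]. The torsion function lies
    below every supersolution that is nonnegative on the closed ball
    ([torsion_le_supersolution]), in particular below the paraboloid that is
    the torsion function without drift. The radial Poisson
    problem is solved by two integrations, and the size of its solution is
    governed by a single constant [E] bounding the flux of the constant 1
    ([radial_comparison]). One can always take [E = 1]. If [rho] vanishes on
    no interval, the potential of the drift is strictly increasing, the
    weight concentrates exponentially and [E] tends to 0
    ([flux_small_of_large_drift]). When [lambda * E] is small, the radial
    nonlinear problem is a contraction on functions with values between 0 and
    1/2, because a convex function is Lipschitz on that interval
    ([radial_fixed_point]); the existence of a solution at [lambda] bounds the
    extremal parameter from below. *)

(** * Differential calculus along lines *)

Section Lines.
Context {R : realType} {V : normedModType R}.
Implicit Types (f : V -> R) (x v : V).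

(** Directional derivatives are derivatives at 0 of the restriction to a line,
    so that every statement about them can be proved in one variable. *)
Lemma is_derive_line f x v (df : R) :
  is_derive x v f df <-> is_derive (0 : R) 1 (fun t : R => f (t *: v + x)) df.
Proof.
have E : (fun h : R => h^-1 *: ((f \o shift x) (h *: v) - f x)) =
    (fun h : R => h^-1 *: (((fun t : R => f (t *: v + x)) \o shift 0) (h *: 1)
       - (fun t : R => f (t *: v + x)) 0)).
  apply/funext => h /=; rewrite addr0 scale0r add0r.
  by rewrite [h *: 1]mulr1.
by split => -[D1 D2]; split; move: D1 D2; rewrite /derivable /derive /= -?E // E.
Qed.

Lemma is_derive_val f x v df : is_derive x v f df -> 'D_v f x = df.
Proof. by case. Qed.

Lemma continuous_epsP f x : {for x, continuous f} <->
  forall e : R, 0 < e -> exists2 d : R, 0 < d &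
    forall y, `|y - x| < d -> `|f y - f x| < e.
Proof.
split.
  move=> /cvgrPdist_lt cf e e0; have /nbhs_ballP[d /= d0 H] := cf e e0.
  exists d => // y yx; rewrite distrC; apply: H.
  by rewrite -ball_normE /= distrC.
move=> H; apply/cvgrPdist_lt => e e0; have [d d0 Hd] := H e e0.
apply/nbhs_ballP; exists d => //= y; rewrite -ball_normE /= => yx.
by rewrite distrC; apply: Hd; rewrite distrC.
Qed.

Lemma near_eq_continuous_for f g x :
  (\near x, f x = g x) -> {for x, continuous f} -> {for x, continuous g}.
Proof.
move=> fg cf; have E : f x = g x by exact: nbhs_singleton fg.
change (g @ x --> g x); rewrite -E.
exact: cvg_trans (near_eq_cvg fg) cf.
Qed.

End Lines.

Section OneVariable.
Context {R : realType}.
Implicit Types (f g : R -> R) (x : R).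

Lemma is_derive_along (V : normedModType R) (f g : V -> R) (x v : V) (t : R) :
  is_derive (t *: v + x) v f (g (t *: v + x)) ->
  is_derive t 1 (fun t : R => f (t *: v + x)) (g (t *: v + x)).
Proof.
move=> /is_derive_line D; apply/is_derive_line.
have E : (fun s : R => f (s *: v + (t *: v + x))) =
  (fun s : R => f ((s *: (1 : R) + t) *: v + x)).
  by apply/funext => s; rewrite scalerDl -addrA [s *: 1]mulr1.
by rewrite -E.
Qed.

(** The error is measured by [e * `|h|] with a weak inequality, so that [h = 0]
    needs no separate treatment when this is used as an introduction rule. *)
Lemma is_derive_epsP f x a : is_derive x 1 f a <->
  forall e : R, 0 < e -> exists2 d : R, 0 < d &
    forall h, `|h| < d -> `|f (h + x) - f x - a * h| <= e * `|h|.
Proof.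
have cvgE : (h^-1 *: ((f \o shift x) (h *: 1) - f x) @[h --> 0^'] --> a) <->
    forall e : R, 0 < e -> exists2 d : R, 0 < d &
    forall h, `|h| < d -> `|f (h + x) - f x - a * h| <= e * `|h|.
  split.
    move=> /cvgrPdist_lt cf e e0; have /nbhs_ballP[d /= d0 H] := cf e e0.
    exists d => // h hd; have [->|h0] := eqVneq h 0.
      by rewrite add0r subrr mulr0 subrr normr0 mulr0.
    have := H h; rewrite -ball_normE /= sub0r normrN => /(_ hd h0) /ltW.
    rewrite [h *: 1]mulr1 => Hh.
    have -> : f (h + x) - f x - a * h = - h * (a - h^-1 *: (f (h + x) - f x)).
      by rewrite /GRing.scale /=; field.
    by rewrite normrM normrN mulrC ler_wpM2r.
  move=> H; apply/cvgrPdist_le => e e0; have [d d0 Hd] := H e e0.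
  apply/nbhs_ballP; exists d => //= h; rewrite -ball_normE /= sub0r normrN.
  move=> hd h0; rewrite [h *: 1]mulr1 -(ler_pM2r (_ : 0 < `|h|)) ?normr_gt0//.
  apply: le_trans (Hd h hd); rewrite -normrM -normrN.
  have -> // : - ((a - h^-1 *: (f (h + x) - f x)) * h) = f (h + x) - f x - a * h.
  by rewrite /GRing.scale /=; field.
rewrite -cvgE; split => [[D1 D2]|C].
  by rewrite -D2; exact: D1.
split; first by apply/cvg_ex; exists a.
exact/cvg_lim.
Qed.

Lemma is_derive_continuous f x a : is_derive x 1 f a -> {for x, continuous f}.
Proof.
by move=> [D _]; apply/differentiable_continuous/derivable1_diffP.
Qed.

Lemma is_derive_unique f x a b : is_derive x 1 f a -> is_derive x 1 f b -> a = b.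
Proof. by move=> [_ <-] [_ <-]. Qed.

Lemma mean_value f df (a b : R) : a < b ->
  (forall x, a < x < b -> is_derive x 1 f (df x)) ->
  (forall x, a <= x <= b -> {for x, continuous f}) ->
  exists2 c, a < c < b & f b - f a = df c * (b - a).
Proof.
move=> ab D C; have W : {within `[a, b], continuous f}.
  by apply: continuous_in_subspaceT => x; rewrite inE /= in_itv /= => /C.
have D' x : x \in `]a, b[%R -> is_derive x 1 f (df x).
  by rewrite in_itv /=; exact: D.
by have [c] := MVT ab D' W; rewrite in_itv /=; exists c.
Qed.

(** Were [c] positive, [psi] would be positive on some interval to the right
    of 0, and [phi] would increase there. *)
Lemma second_derivative_at_max (phi psi : R -> R) (c d : R) : 0 < d ->
  (forall t, `|t| < d -> is_derive (t : R) 1 phi (psi t)) -> is_derive (0 : R) 1 psi c ->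
  (forall t, `|t| < d -> phi t <= phi 0) -> psi 0 = 0 /\ c <= 0.
Proof.
move=> d0 Dphi Dpsi Hmax.
have psi0 : psi 0 = 0.
  have D0 : is_derive (0 : R) 1 phi (psi 0) by apply: Dphi; rewrite normr0.
  have I t : (t \in `](- d), d[) = (`|t| < d) by rewrite in_itv /= -ltr_norml.
  apply: (is_derive_unique D0).
  apply: (@derive1_at_max _ _ (- d) d) => [|t|| t]; rewrite ?I ?normr0 //.
  - by lra.
  - by move=> /Dphi [].
  - exact: Hmax.
split => //; rewrite leNgt; apply/negP => c0.
have [//|e e0 He] := (is_derive_epsP psi (0 : R) c).1 Dpsi (c / 2); first by lra.
set h := Num.min e d / 2.
have hp : 0 < h by rewrite /h divr_gt0 // lt_min e0 d0.
have he : h < e by have := ge_min e e d; rewrite lexx /h; lra.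
have hd : h < d by have := ge_min d e d; rewrite lexx orbT /h; lra.
have [t|t|s /andP[s0 sh] E] := @mean_value phi psi 0 h hp.
- by move=> /andP[t0 th]; apply: Dphi; rewrite gtr0_norm //; lra.
- move=> /andP[t0 th]; apply: is_derive_continuous (Dphi t _).
  by rewrite ger0_norm //; lra.
have : `|psi (s + 0) - psi 0 - c * s| <= c / 2 * `|s|.
  by apply: He; rewrite gtr0_norm //; lra.
rewrite addr0 psi0 subr0 (gtr0_norm s0) ler_norml => /andP[H1 _].
have psis : 0 < psi s by nra.
have := Hmax h; rewrite (gtr0_norm hp) => /(_ hd); nra.
Qed.

Lemma le_of_derivative f df (a b : R) : a <= b ->
  (forall x, a < x < b -> is_derive x 1 f (df x)) ->
  (forall x, a <= x <= b -> {for x, continuous f}) ->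
  (forall x, a < x < b -> 0 <= df x) -> f a <= f b.
Proof.
rewrite le_eqVlt => /orP[/eqP -> //|ab] D C H.
have [c cab E] := mean_value ab D C.
rewrite -subr_ge0 E mulr_ge0 ?H // subr_ge0; exact: ltW.
Qed.

End OneVariable.

(** * The maximum principle at a touching point *)

Section Touching.
Context {R : realType} {N : nat}.
Implicit Types (x v : 'rV[R]_N) (u h : 'rV[R]_N -> R).

Lemma is_derive_lincomb (f g : R -> R) (t k a b : R) :
  is_derive t 1 f a -> is_derive t 1 g b ->
  is_derive t 1 (fun s => k * f s - g s) (k * a - b).
Proof. by move=> Df Dg; apply: is_deriveB. Qed.

Lemma continuous_sum (T : topologicalType) (I : Type) (s : seq I)
    (F : I -> T -> R) :
  (forall i, continuous (F i)) -> continuous (fun y : T => \sum_(i <- s) F i y).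
Proof.
move=> cF; elim: s => [|i s IH] z.
  rewrite (_ : (fun y => _) = cst 0); first exact: cvg_cst.
  by apply/funext => y; rewrite big_nil.
rewrite (_ : (fun y => _) = (fun y : T => F i y + \sum_(j <- s) F j y)).
  exact: cvgD (cF i z) (IH z).
by apply/funext => y; rewrite big_cons.
Qed.

Lemma dot_continuous (v : 'rV[R]_N) : continuous (fun x => dot x v).
Proof.
apply: continuous_sum => i x.
apply (@continuousM _ _ (fun y : 'rV[R]_N => y ord0 i) (fun=> v ord0 i)).
  exact: coord_continuous.
exact: cst_continuous.
Qed.

Lemma sqdot_continuous : continuous (fun x : 'rV[R]_N => dot x x).
Proof.
apply: continuous_sum => i x.
by apply (@continuousM _ _ (fun y : 'rV[R]_N => y ord0 i));
  exact: coord_continuous.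
Qed.

Lemma enorm_continuous : continuous (@enorm R N).
Proof.
by move=> x; apply: (continuous_comp (@sqdot_continuous x)); exact: sqrt_continuous.
Qed.

Lemma enorm_ge0 x : 0 <= enorm x. Proof. exact: sqrtr_ge0. Qed.

Lemma sqdot_ge0 x : 0 <= dot x x.
Proof. by apply: sumr_ge0 => i _; rewrite -expr2 sqr_ge0. Qed.

Lemma sqr_enorm x : enorm x ^+ 2 = dot x x.
Proof. by rewrite sqr_sqrtr // sqdot_ge0. Qed.

Lemma coord_le_enorm x i : `|x ord0 i| <= enorm x.
Proof.
rewrite -ler_sqr ?nnegrE ?enorm_ge0 // sqr_enorm real_normK ?num_real //.
rewrite /dot (bigD1 i) //= expr2 lerDl; apply: sumr_ge0 => j _.
by rewrite -expr2 sqr_ge0.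
Qed.

Lemma unit_ball_open : open (@unit_ball R N).
Proof.
rewrite (_ : unit_ball = enorm @^-1` [set r | r < 1]) //.
by apply: open_comp => [x _|]; [exact: enorm_continuous|exact: open_lt].
Qed.

Lemma closed_unit_ball_compact : compact (@closed_unit_ball R N).
Proof.
apply: bounded_closed_compact.
  exists 1; split => // M M1 x /= x1.
  rewrite /Num.norm /= mx_normrE; apply/bigmax_leP; split.
    by rewrite (le_trans ler01) // ltW.
  move=> [i j] _ /=; rewrite (ord1 i); apply: le_trans (ltW M1).
  exact: le_trans (coord_le_enorm x j) x1.
rewrite (_ : closed_unit_ball = enorm @^-1` [set r | r <= 1]) //.
by apply: (continuous_closedP _).1; [exact: enorm_continuous|exact: closed_le].
Qed.

Lemma unit_ball_sub : (@unit_ball R N) `<=` closed_unit_ball.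
Proof. by move=> x; exact: ltW. Qed.

Lemma line_in_unit_ball x v : unit_ball x ->
  exists2 d : R, 0 < d & forall t, `|t| < d -> unit_ball (t *: v + x).
Proof.
move=> x1; have C : {for (0 : R), continuous (fun t : R => enorm (t *: v + x))}.
  apply: continuous_comp; last exact: enorm_continuous.
  by apply: cvgD; [apply: cvgZl; exact: cvg_id|exact: cvg_cst].
have [|d d0 H] := (continuous_epsP _ _).1 C (1 - enorm x); first by rewrite subr_gt0.
exists d => // t; have := H t; rewrite subr0 scale0r add0r => Ht /Ht.
by rewrite ltr_norml => /andP[_]; rewrite ltrD2r.
Qed.

Lemma class_C2_derive u x v : class_C 2 unit_ball u -> unit_ball x ->
  is_derive x v u ('D_v u x).
Proof. by move=> Cu x1; apply: derivableP; exact: (Cu [::] x _ _).2. Qed.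

Lemma class_C2_derive2 u x v w : class_C 2 unit_ball u -> unit_ball x ->
  is_derive x v ('D_w u) ('D_v ('D_w u) x).
Proof. by move=> Cu x1; apply: derivableP; exact: (Cu [:: w] x _ _).2. Qed.

(** At a maximum of [k * h - u] the gradients of [k * h] and [u] agree, so the
    drift terms agree whatever [A] and [rho] are, and the pure second
    derivatives of [k * h] are at most those of [u]. *)
Lemma Lop_le_of_touch (rho : R -> R) (A k : R) u h x0 :
  class_C 2 unit_ball u -> class_C 2 unit_ball h -> unit_ball x0 ->
  (forall x, unit_ball x -> k * h x - u x <= k * h x0 - u x0) ->
  Lop rho A u x0 <= k * Lop rho A h x0.
Proof.
move=> Cu Ch x01 Hmax.
have P i : k * partial i h x0 = partial i u x0 /\
    k * partial i (partial i h) x0 <= partial i (partial i u) x0.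
  set e := delta_mx ord0 i : 'rV[R]_N.
  have [d d0 Hd] := line_in_unit_ball e x01.
  have [||||] := @second_derivative_at_max R
    (fun t => k * h (t *: e + x0) - u (t *: e + x0))
    (fun t => k * 'D_e h (t *: e + x0) - 'D_e u (t *: e + x0))
    (k * 'D_e ('D_e h) x0 - 'D_e ('D_e u) x0) d.
  - exact: d0.
  - move=> t /Hd tb; apply: is_derive_lincomb.
      by apply: (is_derive_along (g := 'D_e h)); exact: class_C2_derive.
    by apply: (is_derive_along (g := 'D_e u)); exact: class_C2_derive.
  - apply: is_derive_lincomb.
      exact: (is_derive_line ('D_e h) _ _ _).1 (class_C2_derive2 _ _ Ch x01).
    exact: (is_derive_line ('D_e u) _ _ _).1 (class_C2_derive2 _ _ Cu x01).
  - by move=> t td; rewrite scale0r add0r; apply: Hmax; exact: Hd.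
  - by rewrite scale0r add0r => /subr0_eq E1; rewrite subr_le0.
have G : k * dot x0 (grad h x0) = dot x0 (grad u x0).
  rewrite /dot mulr_sumr; apply: eq_bigr => i _.
  by rewrite !mxE mulrCA (P i).1.
rewrite /Lop mulrBr mulrN.
rewrite (_ : k * (A * rho (enorm x0) * dot x0 (grad h x0)) =
  A * rho (enorm x0) * dot x0 (grad u x0)); last by rewrite mulrCA G.
rewrite lerD2r lerN2 /laplacian mulr_sumr; apply: ler_sum => i _.
exact: (P i).2.
Qed.

End Touching.

(** * Comparison with sub- and supersolutions *)

Section Comparison.
Context {R : realType} {N : nat}.
Variables (rho : R -> R) (A : R).
Implicit Types (x : 'rV[R]_N) (u h psi : 'rV[R]_N -> R).

Lemma class_C2_continuous u x :
  class_C 2 unit_ball u -> unit_ball x -> {for x, continuous u}.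
Proof. by move=> Cu x1; exact: (Cu [::] x _ _).1. Qed.

Lemma enorm0 : enorm (0 : 'rV[R]_N) = 0.
Proof.
by rewrite /enorm /dot big1 ?sqrtr0 // => i _; rewrite mxE mul0r.
Qed.

Lemma unit_ball0 : unit_ball (0 : 'rV[R]_N).
Proof. by rewrite /unit_ball /= enorm0. Qed.

(** A zero of [u] would be a minimum, where touching by the zero function
    forces [Lop rho A u] to be nonpositive. *)
Lemma positive_of_Lop_positive u : class_C 2 unit_ball u ->
  (forall x, unit_ball x -> 0 <= u x) ->
  (forall x, unit_ball x -> 0 < Lop rho A u x) ->
  forall x, unit_ball x -> 0 < u x.
Proof.
move=> Cu u0 Lu x x1; rewrite lt_neqAle u0 // andbT; apply/negP => /eqP ux.
have := @Lop_le_of_touch R N rho A 0 u u x Cu Cu x1.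
rewrite !mul0r => H; have := Lu x x1; rewrite ltNge H // => y y1.
by rewrite !mul0r !sub0r -ux oppr0 oppr_le0 u0.
Qed.

(** The factor [k] is the minimum of [u / h] over the set where [h] is
    positive. Because [h] is nonpositive beyond radius [b < 1], this amounts to
    maximizing [h / u] over a compact subset of the open ball, where [u] is
    bounded away from 0. *)
Lemma touch_from_below b u h : b < 1 ->
  class_C 2 unit_ball u -> class_C 2 unit_ball h ->
  (forall x, unit_ball x -> 0 < u x) ->
  (forall x, b <= enorm x -> h x <= 0) -> 0 < h 0 ->
  exists x0 k, [/\ unit_ball x0, 0 < k, 0 < h x0, u x0 = k * h x0 &
    (forall x, unit_ball x -> k * h x <= u x) /\
    Lop rho A u x0 <= k * Lop rho A h x0].
Proof.
move=> b1 Cu Ch u0 hb h0.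
have b0 : 0 <= b.
  rewrite leNgt; apply/negP => b0; have := hb 0.
  by rewrite enorm0 => /(_ (ltW b0)); rewrite leNgt h0.
pose K : set 'rV[R]_N := [set x | enorm x <= b].
have Kball : K `<=` unit_ball by move=> x /= xb; exact: le_lt_trans b1.
have cK : compact K.
  apply: (subclosed_compact _ closed_unit_ball_compact).
    rewrite (_ : K = enorm @^-1` [set r | r <= b]) //.
    by apply: (continuous_closedP _).1; [exact: enorm_continuous|exact: closed_le].
  by move=> x /Kball; exact: unit_ball_sub.
have [|||x0] := @compact_EVT_max _ R (fun x => h x * (u x)^-1) K.
- by exists 0; rewrite /K /= enorm0.
- exact: cK.
- apply: continuous_in_subspaceT => x; rewrite inE => /Kball x1.
  apply (@continuousM R _ h (fun x => (u x)^-1)).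
    exact: class_C2_continuous.
  by apply: continuousV; [rewrite gt_eqF ?u0|exact: class_C2_continuous].
rewrite inE => /Kball x01 Hmax.
have ux0 := u0 _ x01.
have r0 : 0 < h x0 * (u x0)^-1.
  have H := Hmax 0; rewrite inE /K /= enorm0 in H.
  by apply: lt_le_trans (H b0); rewrite divr_gt0 // u0 //; exact: unit_ball0.
have hx0 : 0 < h x0 by rewrite pmulr_lgt0 ?invr_gt0 // in r0.
have k0 : 0 < u x0 / h x0 by rewrite divr_gt0.
have E : u x0 = u x0 / h x0 * h x0 by rewrite divfK // gt_eqF.
have Hk x : unit_ball x -> u x0 / h x0 * h x <= u x.
  move=> x1; have [xb|xb] := leP (enorm x) b.
    have := Hmax x; rewrite inE => /(_ xb).
    rewrite ler_pdivrMr ?u0 // => H.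
    rewrite -ler_pdivlMl // invf_div; exact: H.
  apply: (@le_trans _ _ 0); last by rewrite ltW ?u0.
  by rewrite pmulr_rle0 // hb // ltW.
exists x0, (u x0 / h x0); split => //; split => //.
apply: Lop_le_of_touch => // x x1.
by rewrite -E subrr subr_le0 Hk.
Qed.

Lemma le_sup_ball u x : {within closed_unit_ball, continuous u} ->
  unit_ball x -> u x <= sup_ball u.
Proof.
move=> cu x1; apply: ub_le_sup; last by exists x.
have [|||x0 _ H] := @compact_EVT_max _ R u closed_unit_ball.
- by exists x; exact: unit_ball_sub.
- exact: closed_unit_ball_compact.
- exact: cu.
by exists (u x0) => _ [y y1 <-]; apply: H; rewrite inE; exact: unit_ball_sub.
Qed.

Lemma sup_ball_le u M : (forall x, unit_ball x -> u x <= M) -> sup_ball u <= M.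
Proof.
move=> H; apply: ge_sup => [|_ [x x1 <-]]; last exact: H.
by exists (u 0), 0 => //; exact: unit_ball0.
Qed.

(** At the touching point [1 <= k * Lop rho A h x0 <= k], hence [1 <= k], and
    [k * h] lies below the torsion function. *)
Lemma torsion_ge_barrier b psi h : is_torsion rho A psi -> b < 1 ->
  class_C 2 unit_ball h -> (forall x, b <= enorm x -> h x <= 0) -> 0 < h 0 ->
  (forall x, unit_ball x -> Lop rho A h x <= 1) -> h 0 <= sup_ball psi.
Proof.
move=> [Spsi cpsi psi0 Lpsi _] b1 Ch hb h0 Lh.
have Cpsi : class_C 2 unit_ball psi by exact: Spsi.
have psipos x : unit_ball x -> 0 < psi x.
  apply: positive_of_Lop_positive => // y y1; last by rewrite Lpsi.
  exact/psi0/unit_ball_sub.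
have [x0 [k [x01 k0 _ _ [Hk]]]] := touch_from_below b1 Cpsi Ch psipos hb h0.
rewrite Lpsi // => H.
have k1 : 1 <= k by apply: le_trans H _; rewrite -[leRHS]mulr1 ler_pM2l // Lh.
apply: (@le_trans _ _ (psi 0)); last by apply: le_sup_ball => //; exact: unit_ball0.
apply: le_trans (Hk _ unit_ball0).
by rewrite -[leLHS]mul1r ler_pM2r.
Qed.

(** Shrinking [psi] by a factor [theta < 1] makes the differential inequality
    strict: [Lop rho A (theta * psi)] equals [theta], which is less than 1. *)
Lemma torsion_le_supersolution psi H : is_torsion rho A psi ->
  class_C 2 unit_ball H -> {within closed_unit_ball, continuous H} ->
  (forall x, closed_unit_ball x -> 0 <= H x) ->
  (forall x, unit_ball x -> 1 <= Lop rho A H x) ->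
  forall x, closed_unit_ball x -> psi x <= H x.
Proof.
move=> [Spsi cpsi psi0 Lpsi bpsi] CH cH H0 LH x1 x1b; rewrite leNgt.
apply/negP => Hlt.
have Cpsi : class_C 2 unit_ball psi by exact: Spsi.
have psix : 0 < psi x1 by exact: le_lt_trans (H0 _ x1b) Hlt.
(* close enough to 1 for theta * psi to exceed H at x1 still *)
pose theta := (H x1 / psi x1 + 1) / 2.
have q1 : H x1 / psi x1 < 1 by rewrite ltr_pdivrMr // mul1r.
have q0 : 0 <= H x1 / psi x1 by rewrite divr_ge0 ?H0 // ltW.
have t1 : theta < 1 by rewrite /theta; lra.
have t2 : 0 < theta * psi x1 - H x1.
  rewrite subr_gt0 -ltr_pdivrMr // /theta; lra.
have [|||x0] := @compact_EVT_max _ R (fun x => theta * psi x - H x) closed_unit_ball.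
- by exists x1.
- exact: closed_unit_ball_compact.
- apply: within_continuousB => //; move=> x.
  apply (@continuousM R (subspace (@closed_unit_ball R N)) (fun=> theta) psi).
    exact: cst_continuous.
  exact: cpsi.
rewrite inE => x0b Hmax.
have M0 : 0 < theta * psi x0 - H x0.
  by apply: lt_le_trans t2 _; apply: Hmax; rewrite inE.
have x01 : unit_ball x0.
  rewrite /unit_ball /= lt_neqAle; apply/andP; split; last exact: x0b.
  apply/negP => /eqP s1; move: M0; rewrite bpsi // mulr0 sub0r oppr_gt0.
  by rewrite ltNge H0.
have : Lop rho A H x0 <= theta.
  rewrite -[leRHS]mulr1 -(Lpsi _ x01); apply: Lop_le_of_touch => // x x1'.
  by apply: Hmax; rewrite inE; exact: unit_ball_sub.
by move=> /le_lt_trans/(_ t1); rewrite ltNge LH.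
Qed.

Lemma classical_solution_range (a : \bar R) (f : R -> R) lambda u x :
  is_classical_solution rho A a f lambda u -> unit_ball x -> nldom a (u x).
Proof.
move=> [_ _ u0 sa _] x1; split; first exact/u0/unit_ball_sub.
apply: le_lt_trans sa; apply: ereal_sup_ubound; exists x => //.
by rewrite ger0_norm // u0 //; exact: unit_ball_sub.
Qed.

(** A solution satisfies [Lop rho A u >= lambda * c * u], while the barrier is
    a subsolution of the eigenvalue inequality with constant [kappa]. Touching
    [u] from below by a multiple of the barrier at [x0] gives
    [lambda * c * u x0 <= kappa * u x0]. *)
Lemma classical_parameter_le (a : \bar R) (f : R -> R) lambda u c kappa b h :
  is_classical_solution rho A a f lambda u -> 0 < lambda ->
  (forall t, nldom a t -> 0 < f t) -> (forall t, nldom a t -> c * t <= f t) ->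
  b < 1 -> class_C 2 unit_ball h -> (forall x, b <= enorm x -> h x <= 0) ->
  0 < h 0 -> (forall x, unit_ball x -> Lop rho A h x <= kappa * h x) ->
  lambda * c <= kappa.
Proof.
move=> S l0 fpos fc b1 Ch hb h0 Lh.
have ran := classical_solution_range S.
have [Cu cu u0 _ [Lu _]] := S.
have upos x : unit_ball x -> 0 < u x.
  apply: positive_of_Lop_positive => // y y1; first exact/u0/unit_ball_sub.
  by rewrite Lu // mulr_gt0 // fpos //; exact: ran.
have [x0 [k [x01 k0 hx0 ux0 [Hk]]]] := touch_from_below b1 Cu Ch upos hb h0.
rewrite Lu // => H.
have H1 := fc _ (ran _ x01); have H2 := Lh _ x01.
have := upos _ x01 => up.
rewrite -(ler_pM2r up) {2}ux0 -mulrA (le_trans (ler_wpM2l (ltW l0) H1)) //.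
by rewrite (le_trans H) // mulrCA ler_pM2l.
Qed.

End Comparison.

(** * Radial functions of class C^2 *)

Section DotProduct.
Context {R : realType} {N : nat}.
Implicit Types (x v w : 'rV[R]_N).

Lemma dotC x v : dot x v = dot v x.
Proof. by apply: eq_bigr => i _; rewrite mulrC. Qed.

Lemma dot_line x v w (t : R) : dot (t *: v + x) w = t * dot v w + dot x w.
Proof.
rewrite /dot mulr_sumr -big_split /=; apply: eq_bigr => i _.
by rewrite !mxE mulrDl mulrA.
Qed.

Lemma sqdot_line x v (t : R) :
  dot (t *: v + x) (t *: v + x) = t ^+ 2 * dot v v + t * (2 * dot x v) + dot x x.
Proof.
by rewrite dot_line (dotC v (_ + _)) (dotC x (_ + _)) !dot_line (dotC v x); ring.
Qed.

Lemma dot0l v : dot (0 : 'rV[R]_N) v = 0.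
Proof. by rewrite /dot big1 // => i _; rewrite mxE mul0r. Qed.

Lemma enormZ (t : R) v : enorm (t *: v) = `|t| * enorm v.
Proof.
rewrite /enorm -(addr0 (t *: v)) sqdot_line !dot0l mulr0 mulr0 !addr0.
by rewrite sqrtrM ?sqr_ge0 // sqrtr_sqr.
Qed.

Lemma enorm_eq0 x : (enorm x == 0) = (x == 0).
Proof.
apply/eqP/eqP => [x0|->]; last exact: enorm0.
apply/rowP => i; apply/eqP; rewrite mxE -normr_le0 -x0.
exact: coord_le_enorm.
Qed.

Lemma enorm_gt0 x : (0 < enorm x) = (x != 0).
Proof. by rewrite lt_neqAle enorm_ge0 andbT eq_sym enorm_eq0. Qed.

Lemma dot_le_enorm x v : `|dot x v| <= enorm x * \sum_i `|v ord0 i|.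
Proof.
rewrite /dot mulr_sumr (le_trans (ler_norm_sum _ _ _)) //.
by apply: ler_sum => i _; rewrite normrM ler_wpM2r // coord_le_enorm.
Qed.

Lemma dot_delta x i : dot x (delta_mx ord0 i) = x ord0 i.
Proof.
rewrite /dot (bigD1 i) //= mxE !eqxx mulr1 big1 ?addr0 // => j ji.
by rewrite mxE (negbTE ji) andbF mulr0.
Qed.

Lemma is_derive_enorm x v : x != 0 -> is_derive x v (@enorm R N) (dot x v / enorm x).
Proof.
move=> x0; apply/is_derive_line.
pose q (t : R) := t ^+ 2 * dot v v + t * (2 * dot x v) + dot x x.
have D : is_derive (0 : R) 1 q (2 * dot x v).
  by apply: trigger_derive; rewrite /GRing.scale /=; ring.
have q0 : q 0 = dot x x by rewrite /q expr2 !mul0r !add0r.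
have E : (fun t : R => enorm (t *: v + x)) = Num.sqrt \o q.
  by apply/funext => t; rewrite /enorm sqdot_line.
have S : is_derive (q 0) 1 Num.sqrt (2 * enorm x)^-1.
  by rewrite q0; apply: is_derive1_sqrt; rewrite -sqr_enorm exprn_gt0 ?enorm_gt0.
rewrite E (_ : dot x v / enorm x = (2 * enorm x)^-1 * (2 * dot x v)).
  exact: (@is_derive1_comp _ _ q).
by field; rewrite enorm_eq0.
Qed.

Lemma is_derive_radial (phi : R -> R) (d : R) x v : x != 0 ->
  is_derive (enorm x) 1 phi d ->
  is_derive x v (phi \o (@enorm R N)) (d * (dot x v / enorm x)).
Proof.
move=> x0 Dphi; apply/is_derive_line.
have D := (is_derive_line _ _ _ _).1 (is_derive_enorm v x0).
apply: (@is_derive1_comp _ phi (fun t : R => enorm (t *: v + x))) => //.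
by rewrite scale0r add0r.
Qed.

End DotProduct.

(** For [u x = U (enorm x)], the gradient is [V (enorm x)] times [x] and the
    Hessian is [V] times the identity plus [Z] times the projection onto the
    direction of [x], where [V r = U' r / r] and [Z r = r * V' r]. With [V] and
    [Z] as data, the regularity of [u] at the origin reduces to their
    continuity at 0 together with [Z 0 = 0]. *)
Section RadialC2.
Context {R : realType} {N : nat}.
Variables (U V Z : R -> R).
Hypothesis dU : forall r : R, 0 < r < 1 -> is_derive r 1 U (r * V r).
Hypothesis dV : forall r : R, 0 < r < 1 -> is_derive r 1 V (Z r / r).
Hypothesis cU0 : {for (0 : R), continuous U}.
Hypothesis cV : forall r : R, 0 <= r < 1 -> {for r, continuous V}.
Hypothesis cZ : forall r : R, 0 <= r < 1 -> {for r, continuous Z}.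
Hypothesis Z0 : Z 0 = 0.

Implicit Types (x v w : 'rV[R]_N).
Notation u := (fun x : 'rV[R]_N => U (enorm x)).

(** This makes the origin a critical point of [x |-> U (enorm x)], although
    the norm is not differentiable there. *)
Lemma radial_quadratic_at0 : exists2 C : R, 0 < C & exists2 d : R, 0 < d &
  forall r : R, 0 <= r < d -> `|U r - U 0| <= C * r ^+ 2.
Proof.
have [||d d0 Hd] := (continuous_epsP V (0 : R)).1 (cV _) 1; rewrite ?lexx ?ltr01 //.
exists (`|V 0| + 1); first by rewrite ltr_wpDl.
exists (Num.min d 1) => [|r]; first by rewrite lt_min d0 ltr01.
rewrite le_eqVlt lt_min => /andP[/orP[/eqP <-|r0] /andP[rd r1]].
  by rewrite subrr normr0 expr2 mulr0 mulr0.
have [s|s /andP[s0 sr]|c /andP[c0 cr] ->] :=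
    @mean_value R U (fun r => r * V r) 0 r r0.
- by move=> /andP[s0 sr]; apply: dU; rewrite s0 (lt_trans sr).
- move: s0; rewrite le_eqVlt => /orP[/eqP <- //|s0].
  by apply: is_derive_continuous (dU _); rewrite s0 (le_lt_trans sr).
rewrite subr0 !normrM (gtr0_norm c0) (gtr0_norm r0).
have Vc : `|V c| <= `|V 0| + 1.
  have := Hd c; rewrite subr0 (gtr0_norm c0) => /(_ (lt_trans cr rd)) H.
  have := ler_distD 0 (V c) (V 0); rewrite subr0 sub0r normrN.
  by have := lerB_dist (V c) (V 0); lra.
have := normr_ge0 (V c); set a := `|V c| in Vc *; set b := `|V 0| + 1 in Vc *.
by move=> a0; rewrite expr2 mulrA ler_pM2r // mulrC ler_pM // ltW.
Qed.

Lemma radial_derive x v : unit_ball x ->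
  is_derive x v u (dot x v * V (enorm x)).
Proof.
move=> x1; have [->|x0] := eqVneq x 0.
  rewrite dot0l mul0r; apply/is_derive_line/is_derive_epsP => e e0.
  have [C C0 [d d0 H]] := radial_quadratic_at0.
  set n := enorm v; have n0 : 0 <= n by exact: enorm_ge0.
  exists (Num.min (d / (n + 1)) (e / (C * n ^+ 2 + 1))) => [|h].
    by rewrite lt_min !divr_gt0 // ?ltr_wpDl ?mulr_ge0 ?sqr_ge0 // ltW.
  rewrite lt_min => /andP[h1 h2].
  rewrite !addr0 scale0r enormZ enorm0 mul0r subr0 -/n.
  rewrite ltr_pdivlMr ?ltr_wpDl // in h1.
  rewrite ltr_pdivlMr ?ltr_wpDl ?mulr_ge0 ?sqr_ge0 ?(ltW C0) // in h2.
  have a0 := normr_ge0 h.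
  have := H (`|h| * n); rewrite mulr_ge0 //= => /(_ _)/le_trans; apply; nra.
have r0 : 0 < enorm x by rewrite enorm_gt0.
rewrite (_ : dot x v * _ = enorm x * V (enorm x) * (dot x v / enorm x)).
  by apply: is_derive_radial => //; apply: dU; rewrite r0.
by field; rewrite enorm_eq0.
Qed.

Lemma near_unit_ball x : unit_ball x -> \near x, unit_ball x.
Proof. by move=> x1; apply: open_nbhs_nbhs; split => //; exact: unit_ball_open. Qed.

Lemma near_unit_ball_eq (f g : 'rV[R]_N -> R) x : unit_ball x ->
  (forall y, unit_ball y -> f y = g y) -> \near x, f x = g x.
Proof.
by move=> x1 fg; apply: filterS (near_unit_ball x1) => y; exact: fg.
Qed.

(** At the origin the quotient by [enorm x ^+ 2] is 0 by convention, which is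
    the correct value since [Z 0 = 0]. *)
Lemma radial_derive2 x v w : unit_ball x ->
  is_derive x w ('D_v u) (dot w v * V (enorm x) +
    dot x v * dot x w / enorm x ^+ 2 * Z (enorm x)).
Proof.
move=> x1.
apply: (@near_eq_is_derive _ _ _ (fun y => dot y v * V (enorm y))).
  apply: near_unit_ball_eq x1 _ => y y1; apply: esym.
  exact: (is_derive_val (radial_derive v y1)).
have [->|x0] := eqVneq x 0.
  rewrite !dot0l !mul0r addr0 enorm0; apply/is_derive_line/is_derive_epsP => e e0.
  set n := enorm w; have n0 : 0 <= n by exact: enorm_ge0.
  set q := dot w v; have q0 := normr_ge0 q.
  have [||d d0 H] := (continuous_epsP V (0 : R)).1 (cV _) (e / (`|q| + 1)).
  - by rewrite lexx ltr01.
  - by rewrite divr_gt0 // ltr_wpDl.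
  exists (d / (n + 1)) => [|h h1]; first by rewrite divr_gt0 // ltr_wpDl.
  rewrite ltr_pdivlMr ?ltr_wpDl // in h1.
  rewrite !addr0 scale0r dot0l mul0r subr0 enormZ -/n.
  rewrite -{1}(addr0 (h *: w)) dot_line dot0l addr0 -/q.
  have a0 := normr_ge0 h.
  have := H (`|h| * n); rewrite subr0 ger0_norm ?mulr_ge0 // => /(_ _) H1.
  have {}H1 : `|V (`|h| * n) - V 0| < e / (`|q| + 1) by apply: H1; nra.
  rewrite ltr_pdivlMr ?ltr_wpDl // in H1.
  rewrite (_ : h * q * _ - q * V 0 * h = h * (q * (V (`|h| * n) - V 0))); last by ring.
  rewrite !normrM mulrC ler_wpM2r //.
  have := normr_ge0 (V (`|h| * n) - V 0); nra.
have r0 : 0 < enorm x by rewrite enorm_gt0.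
have DV := @is_derive_radial R N V (Z (enorm x) / enorm x) x w x0 (dV _).
have Dd : is_derive x w (fun y => dot y v) (dot w v).
  apply/is_derive_line; rewrite (_ : (fun t : R => _) = fun t => t * dot w v + dot x v).
    by apply: trigger_derive; rewrite /GRing.scale /=; ring.
  by apply/funext => t; rewrite dot_line.
have r01 : 0 < enorm x < 1 by rewrite r0.
have DM : is_derive x w (fun y => dot y v * V (enorm y)) _ :=
  is_deriveM Dd (DV r01).
apply: (is_derive_eq DM).
by rewrite /GRing.scale /=; field; rewrite enorm_eq0.
Qed.

Lemma continuous_radial (phi : R -> R) x :
  {for enorm x, continuous phi} -> {for x, continuous (phi \o (@enorm R N))}.
Proof. by move=> C; apply: continuous_comp; [exact: enorm_continuous|]. Qed.

(** The homogeneous factor of degree 0 is bounded and [Z] vanishes at 0, which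
    gives continuity at the origin. *)
Lemma radial_derive2_continuous x v w : unit_ball x ->
  {for x, continuous (fun x => dot w v * V (enorm x) +
    dot x v * dot x w / enorm x ^+ 2 * Z (enorm x))}.
Proof.
move=> x1; have r01 : 0 <= enorm x < 1 by rewrite enorm_ge0.
apply (@continuousD R _ _ (fun x => dot w v * V (enorm x))).
  apply (@continuousM R _ (fun=> dot w v) (V \o (@enorm R N))).
    exact: cst_continuous.
  exact/continuous_radial/cV.
have [->|x0] := eqVneq x 0.
  apply/continuous_epsP => e e0.
  set Cv := \sum_i `|v ord0 i|; set Cw := \sum_i `|w ord0 i|.
  have Cv0 : 0 <= Cv by exact: sumr_ge0.
  have Cw0 : 0 <= Cw by exact: sumr_ge0.
  have [||d d0 H] := (continuous_epsP (Z \o (@enorm R N)) 0).1 _ (e / (Cv * Cw + 1)).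
  - by apply: continuous_radial; rewrite enorm0; apply: cZ; rewrite lexx ltr01.
  - by rewrite divr_gt0 // ltr_wpDl // mulr_ge0.
  exists d => // y /H; rewrite /= enorm0 Z0 subr0 dot0l !mul0r subr0.
  rewrite ltr_pdivlMr ?ltr_wpDl ?mulr_ge0 // => Hy.
  have [->|y0] := eqVneq y 0; first by rewrite dot0l !mul0r normr0.
  have r0 : 0 < enorm y by rewrite enorm_gt0.
  apply: le_lt_trans Hy; rewrite normrM mulrC ler_wpM2l //.
  rewrite normrM normfV normrX (gtr0_norm r0) ler_pdivrMr ?exprn_gt0 //.
  apply: (@le_trans _ _ ((enorm y * Cv) * (enorm y * Cw))).
    by rewrite normrM ler_pM // dot_le_enorm.
  have := sqr_ge0 (enorm y); have := mulr_ge0 Cv0 Cw0; nra.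
apply (@continuousM R _ (fun x => dot x v * dot x w / enorm x ^+ 2) (Z \o (@enorm R N))).
  apply (@continuousM R _ (fun x => dot x v * dot x w) (fun x => (enorm x ^+ 2)^-1)).
    by apply (@continuousM R _ (fun x => dot x v) (fun x => dot x w));
      exact: dot_continuous.
  apply: continuousV; first by rewrite sqrf_eq0 enorm_eq0.
  by apply (@continuousM R _ (@enorm R N) (@enorm R N)); exact: enorm_continuous.
exact/continuous_radial/cZ.
Qed.

Lemma radial_class_C2 : class_C 2 unit_ball u.
Proof.
have Cu x : unit_ball x -> {for x, continuous u}.
  move=> x1; apply: continuous_radial.
  have := enorm_ge0 x; rewrite le_eqVlt => /orP[/eqP <- //|r0].
  by apply: is_derive_continuous (dU _); rewrite r0.
have CDu v x : unit_ball x -> {for x, continuous ('D_v u)}.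
  move=> x1; apply: (near_eq_continuous_for (f := fun y => dot y v * V (enorm y))).
    apply: near_unit_ball_eq x1 _ => y y1; apply: esym.
    exact: (is_derive_val (radial_derive v y1)).
  apply (@continuousM R _ (fun x => dot x v) (V \o (@enorm R N))).
    exact: dot_continuous.
  by apply/continuous_radial/cV; rewrite enorm_ge0.
have CDDu v w x : unit_ball x -> {for x, continuous ('D_w ('D_v u))}.
  move=> x1; apply: near_eq_continuous_for (@radial_derive2_continuous x v w x1).
  apply: near_unit_ball_eq x1 _ => y y1; apply: esym.
  exact: (is_derive_val (radial_derive2 v w y1)).
move=> [|v [|w [|? ?]]] x //= _ x1; split => //.
- exact: Cu.
- by move=> _ v; have [] := radial_derive v x1.
- exact: CDu.
- by move=> _ w; have [] := radial_derive2 v w x1.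
- exact: CDDu.
Qed.

Lemma radial_Lop (rho : R -> R) (A : R) x : unit_ball x ->
  Lop rho A u x = - (N%:R * V (enorm x) + Z (enorm x))
    - A * rho (enorm x) * (enorm x ^+ 2 * V (enorm x)).
Proof.
move=> x1; rewrite /Lop; congr (- _ - _ * _).
  rewrite /laplacian (eq_bigr (fun i => V (enorm x) +
    x ord0 i * x ord0 i / enorm x ^+ 2 * Z (enorm x))); last first.
    move=> i _; rewrite /partial (is_derive_val (radial_derive2 _ _ x1)) !dot_delta mxE.
    by rewrite !eqxx mul1r.
  rewrite big_split /= sumr_const card_ord mulr_natl; congr (_ + _).
  rewrite -!mulr_suml -/(dot x x) -sqr_enorm.
  have [x0|x0] := eqVneq (enorm x) 0; first by rewrite x0 Z0 mulr0.
  by rewrite divff ?mul1r // sqrf_eq0.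
rewrite /dot sqr_enorm /dot mulr_suml; apply: eq_bigr => i _.
by rewrite mxE /partial (is_derive_val (radial_derive _ x1)) dot_delta mulrA.
Qed.

End RadialC2.

(** * A quintic step function *)

Section Clamp.
Context {R : realType}.
Implicit Types (a b x y h : R).

Definition clamp a b x : R := Num.max a (Num.min b x).

Lemma clamp_id a b x : a <= x <= b -> clamp a b x = x.
Proof. by rewrite /clamp => /andP[ax xb]; rewrite min_r // max_r. Qed.

Lemma clamp_le a b x : a <= b -> x <= a -> clamp a b x = a.
Proof. by rewrite /clamp => ab xa; rewrite min_r ?max_l // (le_trans xa). Qed.

Lemma clamp_ge a b x : a <= b -> b <= x -> clamp a b x = b.
Proof. by rewrite /clamp => ab xb; rewrite min_l ?max_r. Qed.

Lemma clampP a b x : a <= b ->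
  [\/ x <= a /\ clamp a b x = a, b <= x /\ clamp a b x = b |
      a < x < b /\ clamp a b x = x].
Proof.
move=> ab; have [xa|ax] := leP x a; first by apply: Or31; rewrite clamp_le.
have [bx|xb] := leP b x; first by apply: Or32; rewrite clamp_ge.
by apply: Or33; rewrite clamp_id ?ax ?xb ?ltW.
Qed.

Lemma clamp_itv a b x : a <= b -> a <= clamp a b x <= b.
Proof.
move=> ab; case: (clampP x ab) => -[xab ->]; rewrite ?lexx ?ab //.
by case/andP: xab => /ltW -> /ltW ->.
Qed.

Lemma clamp_dist a b x y : a <= b -> `|clamp a b x - clamp a b y| <= `|x - y|.
Proof.
move=> ab; wlog xy : x y / x <= y => [W|].
  by case/orP: (le_total x y) => xy; last rewrite distrC [leRHS]distrC; exact: W.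
rewrite [leRHS]distrC (@ger0_norm _ (y - x)) ?subr_ge0 // ler_norml.
by case: (clampP x ab) => -[? ->]; case: (clampP y ab) => -[? ->]; lra.
Qed.

Lemma clamp_continuous a b : a <= b -> continuous (clamp a b).
Proof.
move=> ab x; apply/continuous_epsP => e e0; exists e => // y.
exact/le_lt_trans/clamp_dist.
Qed.

(** When [P'] vanishes at both ends of the unit interval, freezing [P] outside
    it causes no corner. *)
Lemma is_derive_clamp (P dP : R -> R) (s : R) :
  (forall t : R, is_derive t 1 P (dP t)) -> dP 0 = 0 -> dP 1 = 0 ->
  is_derive s 1 (P \o clamp 0 1) (dP (clamp 0 1 s)).
Proof.
move=> D d0 d1; apply/is_derive_epsP => e e0.
have [d dp H] := (is_derive_epsP _ _ _).1 (D (clamp 0 1 s)) e e0.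
(* clamping is 1-Lipschitz, so only the defect of its linearization is left *)
have main h : `|h| < d ->
    dP (clamp 0 1 s) * (clamp 0 1 (h + s) - clamp 0 1 s - h) = 0 ->
    `|(P \o clamp 0 1) (h + s) - (P \o clamp 0 1) s - dP (clamp 0 1 s) * h|
      <= e * `|h|.
  move=> hd E0 /=; set c := clamp 0 1 s in E0 H *.
  set c' := clamp 0 1 (h + s) in E0 *.
  have cc : `|c' - c| <= `|h|.
    by have := @clamp_dist 0 1 (h + s) s ler01; rewrite addrK.
  have := H (c' - c) (le_lt_trans cc hd); rewrite subrK => Hc.
  rewrite (_ : _ - _ * h = P c' - P c - dP c * (c' - c)).
    by apply: le_trans Hc _; rewrite ler_wpM2l // ltW.
  by apply/eqP; rewrite -subr_eq0 -E0; apply/eqP; ring.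
have [[_ E]|[_ E]|[/andP[s0 s1] E]] := clampP s (ler01 : (0 : R) <= 1).
- by exists d => // h hd; apply: main; rewrite ?E ?d0 ?mul0r.
- by exists d => // h hd; apply: main; rewrite ?E ?d1 ?mul0r.
- exists (Num.min d (Num.min s (1 - s))).
    by rewrite !lt_min dp s0 subr_gt0.
  move=> h; rewrite !lt_min => /and3P[hd hs hs1]; apply: main => //.
  rewrite E clamp_id; first by ring.
  by move: hs hs1; rewrite !ltr_norml => /andP[? ?] /andP[? ?]; lra.
Qed.

End Clamp.

Section Step.
Context {R : realType}.
Implicit Types (s t : R).

(** The quintic with [step 0 = 0] and [step 1 = 1] whose first two derivatives
    vanish at both points: its clamped version is of class C^2. *)
Definition step s : R := 6 * s ^+ 5 - 15 * s ^+ 4 + 10 * s ^+ 3.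
Definition dstep s : R := 30 * s ^+ 2 * (1 - s) ^+ 2.
Definition ddstep s : R := 60 * s * (1 - s) * (1 - 2 * s).

Lemma is_derive_step s : is_derive s 1 step (dstep s).
Proof. by apply: trigger_derive; rewrite /dstep /GRing.scale /=; ring. Qed.

Lemma is_derive_dstep s : is_derive s 1 dstep (ddstep s).
Proof. by apply: trigger_derive; rewrite /ddstep /GRing.scale /=; ring. Qed.

Lemma step_compl s : 1 - step s = step (1 - s).
Proof. by rewrite /step; ring. Qed.

Lemma step_ge_cube s : 0 <= s <= 1 -> s ^+ 3 <= step s.
Proof.
move=> /andP[s0 s1]; rewrite -subr_ge0.
rewrite (_ : step s - _ = s ^+ 3 * ((1 - s) * (9 - 6 * s))); last first.
  by rewrite /step; ring.
by rewrite mulr_ge0 ?exprn_ge0 // mulr_ge0; lra.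
Qed.

Lemma step_le_half s : 0 <= s <= 1 / 2 -> step s <= 1 / 2.
Proof.
move=> /andP[s0 s1]; rewrite -subr_ge0.
rewrite (_ : 1 / 2 - step s = (1 - 2 * s) / 2 *
    (1 + 2 * s * (1 - s) + 6 * s ^+ 2 * (1 - s) ^+ 2)).
  apply: mulr_ge0; first by rewrite divr_ge0 //; lra.
  by rewrite !addr_ge0 // ?mulr_ge0 ?sqr_ge0 //; lra.
by rewrite /step; field.
Qed.

End Step.

(** * A radial barrier supported in a smaller ball *)

Section Barrier.
Context {R : realType} {N : nat}.
Variables (al be K : R).
Hypotheses (al0 : 0 < al) (albe : al < be) (K0 : 0 < K).

Implicit Types r s : R.

Let l := be - al.
Let l0 : 0 < l. Proof. by rewrite /l subr_gt0. Qed.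

Definition barrier_pos (r : R) : R := clamp 0 1 ((r - al) / (be - al)).
(** Constant equal to [K] up to radius [al], zero from radius [be] on, and
    decreasing in between. *)
Definition barrier_profile r : R := K * (1 - step (barrier_pos r)).
(* dividing by the maximum of r and al instead of r changes nothing, since
   dstep vanishes below al, but makes continuity at 0 immediate *)
Let V r : R := - (K / l) * (dstep (barrier_pos r) / Num.max r al).
Let Z r : R :=
  - (K / l) * (ddstep (barrier_pos r) / l - dstep (barrier_pos r) / Num.max r al).

Definition barrier (x : 'rV[R]_N) : R := barrier_profile (enorm x).

Lemma barrier_pos_le r : r <= al -> barrier_pos r = 0.
Proof.
by move=> ral; rewrite /barrier_pos clamp_le // pmulr_lle0 ?invr_gt0 // subr_le0.
Qed.

Lemma barrier_pos_ge r : be <= r -> barrier_pos r = 1.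
Proof.
by move=> ber; rewrite /barrier_pos clamp_ge // ler_pdivlMr // mul1r lerD2r.
Qed.

Let dstep_max r : 0 < r ->
  dstep (barrier_pos r) / Num.max r al = dstep (barrier_pos r) / r.
Proof.
move=> r0; case: (leP r al) => // ral.
by rewrite barrier_pos_le // /dstep expr2 !(mulr0, mul0r).
Qed.

Let is_derive_affine (r : R) : is_derive r 1 (fun r => (r - al) / (be - al)) l^-1.
Proof. by apply: trigger_derive; rewrite /GRing.scale /=; ring. Qed.

Let is_derive_step_pos r :
  is_derive r 1 (step \o barrier_pos) (dstep (barrier_pos r) / l).
Proof.
have D1 : is_derive ((fun r => (r - al) / (be - al)) r) 1 (step \o clamp 0 1)
    (dstep (barrier_pos r)).
  apply: is_derive_clamp; first exact: is_derive_step.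
    by rewrite /dstep ?expr0n /= !(mulr0, mul0r).
  by rewrite /dstep subrr ?expr0n /= !(mulr0, mul0r).
exact (@is_derive1_comp _ _ (fun r => (r - al) / (be - al)) r _ _ D1 (is_derive_affine r)).
Qed.

Let is_derive_dstep_pos r :
  is_derive r 1 (dstep \o barrier_pos) (ddstep (barrier_pos r) / l).
Proof.
have D1 : is_derive ((fun r => (r - al) / (be - al)) r) 1 (dstep \o clamp 0 1)
    (ddstep (barrier_pos r)).
  apply: is_derive_clamp; first exact: is_derive_dstep.
    by rewrite /ddstep ?expr0n /= !(mulr0, mul0r).
  by rewrite /ddstep subrr ?expr0n /= !(mulr0, mul0r).
exact (@is_derive1_comp _ _ (fun r => (r - al) / (be - al)) r _ _ D1 (is_derive_affine r)).
Qed.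

Let dU r : 0 < r < 1 -> is_derive r 1 barrier_profile (r * V r).
Proof.
move=> /andP[r0 _].
have D : is_derive r 1 (fun r => K *: (cst 1 - step \o barrier_pos) r) _ :=
  is_deriveZ K (is_deriveB (is_derive_cst (1 : R) r (1 : R)) (is_derive_step_pos r)).
apply: (is_derive_eq D); rewrite /V dstep_max // /GRing.scale /=.
by field; rewrite !gt_eqF.
Qed.

Let dV r : 0 < r < 1 -> is_derive r 1 V (Z r / r).
Proof.
move=> /andP[r0 _].
have W : is_derive r 1 (fun r : R => r^-1) (- r ^- 2 *: 1).
  by apply: (@is_deriveV _ id) => //; rewrite gt_eqF.
have D : is_derive r 1 (fun s => - (K / l) *: ((dstep \o barrier_pos) * (fun r => r^-1)) s) _ :=
  is_deriveZ (- (K / l)) (is_deriveM (is_derive_dstep_pos r) W).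
apply: (near_eq_is_derive (f := fun s => - (K / l) *:
    ((dstep \o barrier_pos) * (fun r => r^-1)) s)); last first.
  apply: (is_derive_eq D); rewrite /Z dstep_max // /GRing.scale /=.
  by field; rewrite !gt_eqF.
near=> s; rewrite /V dstep_max //.
by near: s; apply: lt_nbhsr.
Unshelve. all: by end_near. Qed.

Let barrier_pos_continuous : continuous barrier_pos.
Proof.
move=> r; apply: (@continuous_comp _ _ _ (fun r => (r - al) / (be - al))).
  exact: is_derive_continuous (is_derive_affine r).
exact/clamp_continuous/ler01.
Qed.

Let quot_continuous : continuous (fun r => dstep (barrier_pos r) / Num.max r al).
Proof.
move=> r; apply (@continuousM R _ (dstep \o barrier_pos) (fun r => (Num.max r al)^-1)).
  exact: is_derive_continuous (is_derive_dstep_pos r).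
apply: continuousV; first by rewrite gt_eqF // lt_max al0 orbT.
apply (@continuous_max R R id (fun=> al)); [exact: cvg_id|exact: cvg_cst].
Qed.

Let cV r : 0 <= r < 1 -> {for r, continuous V}.
Proof.
move=> _; apply (@continuousM R _ (fun=> - (K / l))
  (fun r => dstep (barrier_pos r) / Num.max r al)); first exact: cst_continuous.
exact: quot_continuous.
Qed.

Let cZ r : 0 <= r < 1 -> {for r, continuous Z}.
Proof.
move=> _; apply (@continuousM R _ (fun=> - (K / l)) (fun r =>
  ddstep (barrier_pos r) / l - dstep (barrier_pos r) / Num.max r al)).
  exact: cst_continuous.
apply (@continuousB R _ _ (fun r => ddstep (barrier_pos r) / l)
  (fun r => dstep (barrier_pos r) / Num.max r al)); last first.
  exact: quot_continuous.
apply (@continuousM R _ (ddstep \o barrier_pos) (fun=> l^-1)); last exact: cst_continuous.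
apply: continuous_comp; first exact: barrier_pos_continuous.
apply: (@is_derive_continuous _ _ _ (60 * (1 - 6 * barrier_pos r + 6 * barrier_pos r ^+ 2))).
by apply: trigger_derive; rewrite /GRing.scale /=; ring.
Qed.

Let Z0 : Z 0 = 0.
Proof.
by rewrite /Z barrier_pos_le ?(ltW al0) // /dstep /ddstep expr2 !(mulr0, mul0r) subrr mulr0.
Qed.

Let cU0 : {for (0 : R), continuous barrier_profile}.
Proof.
apply (@continuousM R _ (fun=> K) (fun r => 1 - step (barrier_pos r))).
  exact: cst_continuous.
apply (@continuousB R _ R (fun=> (1 : R)) (step \o barrier_pos)).
  exact: cst_continuous.
exact: is_derive_continuous (is_derive_step_pos 0).
Qed.

Lemma barrier_class_C2 : class_C 2 unit_ball barrier.
Proof. exact: radial_class_C2 dU dV cU0 cV cZ Z0. Qed.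

Lemma barrier_outside x : be <= enorm x -> barrier x <= 0.
Proof.
move=> bx; rewrite /barrier /barrier_profile barrier_pos_ge //.
by rewrite step_compl subrr /step !expr0n /= !mulr0 !addr0 subrr mulr0.
Qed.

Lemma barrier_center : barrier 0 = K.
Proof.
rewrite /barrier /barrier_profile enorm0 barrier_pos_le ?(ltW al0) //.
by rewrite /step !expr0n /= !mulr0 !addr0 subrr subr0 mulr1.
Qed.

(** Outside the transition zone [al < r < be] the barrier is locally constant,
    which corresponds to [s = 0] or [s = 1]. Inside it the first order part of
    the radial operator enters only through its coefficient, and a bound of
    this coefficient by [- P / (be - al)] leaves a polynomial in the rescaled
    radius [s]. *)
Lemma barrier_Lop_le (rho : R -> R) (A P : R) x : unit_ball x ->
  (forall r, al < r < be -> (N%:R - 1) / r + A * rho r * r <= - P / (be - al)) ->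
  exists s, [/\ 0 <= s <= 1, barrier x = K * (1 - step s) &
    Lop rho A barrier x <=
      K / (be - al) ^+ 2 * (30 * s * (1 - s) * (2 * (1 - 2 * s) - P * s * (1 - s)))].
Proof.
move=> x1 HP; exists (barrier_pos (enorm x)); split => //.
  exact/clamp_itv/ler01.
rewrite (radial_Lop dU dV cU0 cV Z0) //.
set r := enorm x; have r0 : 0 <= r by exact: enorm_ge0.
have Kl0 : 0 < K / l by rewrite divr_gt0.
have [ral|alr] := leP r al.
  rewrite /V /Z barrier_pos_le // /dstep /ddstep.
  by rewrite !(expr2, mulr0, mul0r, subr0, addr0, oppr0).
have [ber|rbe] := leP be r.
  rewrite /V /Z barrier_pos_ge // /dstep /ddstep.
  by rewrite subrr !(expr2, mulr0, mul0r, subr0, addr0, oppr0).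
have rp : 0 < r by exact: lt_trans alr.
have := HP r; rewrite alr rbe => /(_ isT) H.
rewrite /V /Z dstep_max //.
set s := barrier_pos r; set G := dstep s; set G' := ddstep s.
have G0 : 0 <= G by rewrite /G /dstep mulr_ge0 ?sqr_ge0 // mulr_ge0 ?sqr_ge0.
have -> : - (N%:R * (- (K / l) * (G / r)) + - (K / l) * (G' / l - G / r))
    - A * rho r * (r ^+ 2 * (- (K / l) * (G / r))) =
    K / l * (G' / l + ((N%:R - 1) / r + A * rho r * r) * G).
  by field; rewrite !gt_eqF.
have -> : K / (be - al) ^+ 2 * (30 * s * (1 - s) * (2 * (1 - 2 * s) - P * s * (1 - s)))
   = K / l * (G' / l + (- P / (be - al)) * G).
  by rewrite /G /G' /dstep /ddstep /l; field; rewrite gt_eqF.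
by rewrite ler_pM2l // lerD2l ler_wpM2r.
Qed.

End Barrier.

(** The polynomial [B P s] is the right-hand side of [barrier_Lop_le] up to
    scaling. A large [P] corresponds to a strong outward drift, a nonpositive
    one to the absence of drift in the transition zone. *)
Section BarrierEstimates.
Context {R : realType}.
Implicit Types (s P C : R).

Notation B P s := (30 * s * (1 - s) * (2 * (1 - 2 * s) - P * s * (1 - s))).

(** [B P s] is positive only for [s] at most [4 / P], where its factor [s] makes
    it of order [1 / P]; there [step s] is still at most [1 / 2]. *)
Lemma barrier_drift_le P s : 0 < P -> 0 <= s <= 1 ->
  B P s <= 240 / P /\ B P s <= 240 / P * (2 * (1 - step s)).
Proof.
move=> P0 /andP[s0 s1].
have m0 : 0 <= 30 * s * (1 - s) by rewrite mulr_ge0 ?mulr_ge0 //; lra.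
have q0 : 0 <= 240 / P by apply: divr_ge0; [exact: ler0n|exact: ltW].
have [sh|sh] := leP s (1 / 2).
  have H : B P s <= 240 / P.
    rewrite ler_pdivlMr //.
    have [sP|sP] := leP (s * P) 4; last first.
      have : 2 * (1 - 2 * s) - P * s * (1 - s) <= 0 by nra.
      by move=> neg; nra.
    have b2 : 2 * (1 - 2 * s) - P * s * (1 - s) <= 2 by nra.
    have m1 : 30 * s * (1 - s) * P <= 120 by nra.
    have m2 : 0 <= 30 * s * (1 - s) * P by rewrite mulr_ge0 // ltW.
    nra.
  split => //; apply: le_trans H _; rewrite ler_peMr //.
  by have := @step_le_half R s; rewrite s0 sh => /(_ isT); lra.
have neg : B P s <= 0.
  have : 2 * (1 - 2 * s) - P * s * (1 - s) <= 0.
    have : 0 <= P * s * (1 - s) by rewrite !mulr_ge0 //; lra.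
    lra.
  by move=> ?; rewrite mulr_ge0_le0.
split; first exact: le_trans neg q0.
apply: le_trans neg _; rewrite mulr_ge0 // mulr_ge0 // step_compl.
have := @step_ge_cube R (1 - s); have : 0 <= (1 - s) ^+ 3 by rewrite exprn_ge0 //; lra.
by move=> c0 /(_ _)/(le_trans c0); apply; lra.
Qed.

(** [B (- C) s] is nonpositive as soon as [1 - s <= 2 / (4 + C)]: the second
    derivative wins over the first near the outer edge. Elsewhere [1 - step s]
    is bounded below by the cube of [1 - s]. *)
Lemma barrier_flat_le C s : 0 <= C -> 0 <= s <= 1 ->
  B (- C) s <= 30 * (2 + C) /\
  B (- C) s <= 30 * (2 + C) / (2 / (4 + C)) ^+ 3 * (1 - step s).
Proof.
move=> C0 /andP[s0 s1].
set y := 1 - s; have y0 : 0 <= y by rewrite /y; lra.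
have y1 : y <= 1 by rewrite /y; lra.
have sy0 : 0 <= s * y by rewrite mulr_ge0.
have sy1 : s * y <= 1 by rewrite mulr_ile1.
have c3 : y ^+ 3 <= 1 - step s by rewrite step_compl step_ge_cube // y0.
have C4 : 0 < 2 / (4 + C) by rewrite divr_gt0 //; lra.
have H : B (- C) s <= 30 * (2 + C).
  have [neg|pos] := leP (2 * (1 - 2 * s) - - C * s * (1 - s)) 0.
    apply: (@le_trans _ _ 0); last by lra.
    by rewrite mulr_ge0_le0 // -mulrA mulr_ge0.
  have zle : 2 * (1 - 2 * s) - - C * s * (1 - s) <= 2 + C.
    by rewrite !mulNr opprK -mulrA -/y; nra.
  set z := (X in 30 * s * (1 - s) * X) in pos zle *.
  rewrite (_ : 30 * s * (1 - s) * z = 30 * (s * y * z)); last by rewrite /y; ring.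
  by rewrite ler_pM2l // (le_trans _ zle) // ler_piMl // (ltW pos).
split => //.
have [yle|ylt] := leP y (2 / (4 + C)).
  apply: (@le_trans _ _ 0); last first.
    apply: mulr_ge0; last by apply: le_trans c3; rewrite exprn_ge0.
    by apply: divr_ge0; [lra|rewrite exprn_ge0 // ltW].
  rewrite mulr_ge0_le0 //; first by rewrite -mulrA mulr_ge0.
  rewrite ler_pdivlMr in yle; last by lra.
  have : C * s * y <= C * y by rewrite -mulrA ler_wpM2l // ler_piMl.
  rewrite !mulNr opprK -/y; move: yle; rewrite /y; nra.
apply: le_trans H _; rewrite -mulrA ler_peMr //; first by lra.
rewrite mulrC ler_pdivlMr ?exprn_gt0 // mul1r; apply: le_trans c3.
by rewrite lerXn2r ?nnegrE // ltW.
Qed.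

End BarrierEstimates.

(** * The radial Poisson problem *)

Section Antiderivative.
Context {R : realType}.
Implicit Types (g G : R -> R) (x : R).

(** The open interval around the unit interval makes the derivative two-sided
    at 0 and at 1. *)
Lemma antiderivative_exists g : continuous g ->
  exists G, G 0 = 0 /\ forall x, -1 < x < 2 -> is_derive x 1 G (g x).
Proof.
move=> cg.
(* starting at -1 leaves room to the left of 0 *)
pose F x : R := (\int[lebesgue_measure]_(t in `[(-1 : R), x]) g t)%R.
exists (fun x => F x - F 0); split; first by rewrite subrr.
move=> x /andP[x1 x2].
have I : lebesgue_measure.-integrable `[(-1 : R), 2] (EFin \o g).
  apply: continuous_compact_integrable; first exact: segment_compact.
  exact: continuous_subspaceT.
have [D E] := continuous_FTC1_closed x2 I x1 (cg x).
have DF : is_derive x 1 F (g x) by split; [exact: D|rewrite -derive1E].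
have DB : is_derive x 1 (fun s => F s - F 0) (g x - 0) :=
  is_deriveB DF (is_derive_cst (F 0) x 1).
by rewrite subr0 in DB.
Qed.

Definition antiderivative g : R -> R :=
  xget 0 [set G | G 0 = 0 /\ forall x, -1 < x < 2 -> is_derive x 1 G (g x)].

Lemma antiderivativeP g : continuous g -> antiderivative g 0 = 0 /\
  forall x, -1 < x < 2 -> is_derive x 1 (antiderivative g) (g x).
Proof.
move=> cg; have [G HG] := antiderivative_exists cg.
exact: (@xgetPex _ 0 [set G | G 0 = 0 /\ forall x, -1 < x < 2 -> is_derive x 1 G (g x)] (ex_intro _ G HG)).
Qed.

End Antiderivative.

(** In the radial variable the equation reads [- (m * U')' = m * g], where
    [m r = r ^+ n * expR (A * Q r)], [n + 1] is the dimension and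
    [Q' r = r * q r]. Two integrations solve it; all estimates are comparisons
    of functions through their derivatives. Arguments are clamped to the unit
    interval so that every function is continuous on the whole line. *)
Section RadialSolver.
Context {R : realType}.
Variables (n : nat) (q : R -> R) (A : R).
Hypothesis cq : continuous q.
Hypothesis q0 : forall r : R, 0 <= r <= 1 -> 0 <= q r.
Hypothesis A0 : 0 <= A.
Implicit Types (g h : R -> R) (r s t d e a b : R).

Let c : R -> R := clamp 0 1.
Let cc : continuous c. Proof. exact/clamp_continuous/ler01. Qed.
Let c_id r : 0 <= r <= 1 -> c r = r. Proof. exact: clamp_id. Qed.
Let c_itv r : 0 <= c r <= 1. Proof. exact/clamp_itv/ler01. Qed.

Let sub01 r : 0 <= r <= 1 -> -1 < r < 2.
Proof. by move=> /andP[? ?]; lra. Qed.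

Let near01 (f g : R -> R) r : 0 < r < 1 ->
  (forall s, 0 <= s <= 1 -> f s = g s) -> \near r, f r = g r.
Proof.
move=> /andP[r0 r1] fg; near=> s; apply: fg; apply/andP; split; apply: ltW.
  by near: s; exact: lt_nbhsr.
by near: s; exact: lt_nbhsl.
Unshelve. all: by end_near. Qed.

Definition drift_potential : R -> R := antiderivative (fun t => t * q t).
Definition drift_exp r : R := expR (A * drift_potential (clamp 0 1 r)).
Definition radial_weight r : R := clamp 0 1 r ^+ n * drift_exp r.

Notation Q := drift_potential.
Notation e := drift_exp.
Notation m := radial_weight.

Lemma drift_potentialP : Q 0 = 0 /\
  forall r, -1 < r < 2 -> is_derive r 1 Q (r * q r).
Proof.
apply: antiderivativeP => r; apply (@continuousM R _ id q); first exact: cvg_id.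
exact: cq.
Qed.

Lemma drift_potential_mono r s : 0 <= r -> r <= s -> s <= 1 -> Q r <= Q s.
Proof.
move=> r0 rs s1; apply: (le_of_derivative rs (df := fun t => t * q t)).
- by move=> t /andP[? ?]; apply: drift_potentialP.2; lra.
- move=> t /andP[? ?]; apply: is_derive_continuous (drift_potentialP.2 _ _); lra.
- by move=> t /andP[? ?]; rewrite mulr_ge0 ?q0 //; lra.
Qed.

Lemma drift_exp_gt0 r : 0 < e r. Proof. exact: expR_gt0. Qed.

Lemma is_derive_drift_exp r : 0 < r < 1 -> is_derive r 1 e (e r * (A * (r * q r))).
Proof.
move=> r01; have /andP[r0 r1] := r01.
have D : is_derive r 1 (fun s => expR (A * Q s)) (expR (A * Q r) * (A * (r * q r))).
  have DQ : is_derive r 1 (fun s => A *: Q s) (A *: (r * q r)).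
    by apply: is_deriveZ; apply: drift_potentialP.2; lra.
  exact (@is_derive1_comp _ expR (fun s => A *: Q s) r _ _ (is_derive_expR _) DQ).
rewrite (_ : e r = expR (A * Q r)); last first.
  by rewrite /drift_exp -/(c r) c_id // (ltW r0) ltW.
have E s : 0 <= s <= 1 -> expR (A * Q s) = e s.
  by move=> s01; rewrite /drift_exp -/(c s) c_id.
exact: near_eq_is_derive (near01 r01 E) D.
Qed.

Lemma drift_exp_continuous : continuous e.
Proof.
move=> r; apply: (@continuous_comp _ _ _ (fun s => A * Q (c s)) expR); last first.
  exact: continuous_expR.
apply (@continuousM R _ (fun=> A) (Q \o c)); first exact: cst_continuous.
apply: continuous_comp; first exact: cc.
exact: is_derive_continuous (drift_potentialP.2 _ (sub01 (c_itv r))).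
Qed.

Lemma radial_weight_continuous : continuous m.
Proof.
move=> r; apply (@continuousM R _ (fun s => c s ^+ n) e); last exact: drift_exp_continuous.
apply: (@continuous_comp _ _ _ c (fun s => s ^+ n)); first exact: cc.
exact: exprn_continuous.
Qed.

Lemma radial_weightE r : 0 <= r <= 1 -> m r = r ^+ n * e r.
Proof. by move=> r01; rewrite /radial_weight -/(c r) c_id. Qed.

Lemma radial_weight_ge0 r : 0 <= m r.
Proof.
by rewrite mulr_ge0 ?(ltW (drift_exp_gt0 r)) // exprn_ge0 //; case/andP: (c_itv r).
Qed.

Lemma drift_exp_ratio r s : 0 <= r <= 1 -> 0 <= s <= 1 ->
  e r = expR (- (A * (Q s - Q r))) * e s.
Proof.
move=> r01 s01; rewrite /drift_exp -!/(c _) !c_id // -expRD; congr expR.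
by ring.
Qed.

(** This is where nonnegative drift helps: the mass that the weight puts at
    [r] is exponentially small compared with that at [s] once [Q] has grown. *)
Lemma radial_weight_ratio r s : 0 <= r -> r <= s -> s <= 1 ->
  m r <= expR (- (A * (Q s - Q r))) * m s.
Proof.
move=> r0 rs s1; rewrite !radial_weightE; try by apply/andP; split; lra.
rewrite (@drift_exp_ratio r s); try by apply/andP; split; lra.
rewrite mulrCA ler_pM2l ?expR_gt0 // ler_wpM2r ?(ltW (drift_exp_gt0 s)) //.
by rewrite lerXn2r ?nnegrE //; lra.
Qed.

Lemma radial_weight_mono r s : 0 <= r -> r <= s -> s <= 1 -> m r <= m s.
Proof.
move=> r0 rs s1; apply: (le_trans (radial_weight_ratio r0 rs s1)).
rewrite ler_piMl ?radial_weight_ge0 // -expR0 ler_expR oppr_le0 mulr_ge0 //.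
by rewrite subr_ge0 drift_potential_mono.
Qed.

Section Solve.
Variable g : R -> R.
Hypothesis cg : continuous g.

(** The flux [- m * U'], obtained from the first integration. *)
Definition radial_flux : R -> R := antiderivative (fun t => m t * g t).
Notation G := radial_flux.

Lemma radial_fluxP : G 0 = 0 /\
  forall r, -1 < r < 2 -> is_derive r 1 G (m r * g r).
Proof.
apply: antiderivativeP => r; apply (@continuousM R _ m g); last exact: cg.
exact: radial_weight_continuous.
Qed.

(* the value at 0 is the limit of the quotient *)
Let K r : R := if r <= 0 then g 0 / n.+1%:R else G r / r ^+ n.+1.

(** The function [- U' r / r], including its limit at 0. *)
Definition radial_slope r : R := K r * (e r)^-1.
Notation V := radial_slope.

Let e0 : e 0 = 1.
Proof. by rewrite /drift_exp -/(c 0) c_id ?lexx ?ler01 // drift_potentialP.1 mulr0 expR0. Qed.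

(* near 0 the integrand m * g is close to g 0 * t ^+ n *)
Let flux_near0 eps : 0 < eps -> exists2 d, 0 < d & forall r, 0 < r < d ->
  `|G r - g 0 * (r ^+ n.+1 / n.+1%:R)| <= eps * (r ^+ n.+1 / n.+1%:R).
Proof.
move=> eps0.
have C : {for (0 : R), continuous (fun t => e t * g t)}.
  apply (@continuousM R _ e g); last exact: cg.
  exact: drift_exp_continuous.
have [d d0 Hd] := (continuous_epsP _ _).1 C eps eps0.
rewrite e0 mul1r in Hd.
have D (k : R) r : -1 < r < 2 -> is_derive r 1
    (fun t => k * (t ^+ n.+1 / n.+1%:R)) (k * r ^+ n).
  move=> _.
  have P : is_derive r 1 (fun t : R => t ^+ n.+1) (n.+1%:R * r ^+ n).
    split; first exact: exprn_derivable.
    by rewrite exp_derive /GRing.scale /= mulr1.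
  have P' : is_derive r 1 (fun t : R => (k / n.+1%:R) *: t ^+ n.+1) _ :=
    is_deriveZ (k / n.+1%:R) P.
  rewrite (_ : (fun t => _) = (fun t : R => (k / n.+1%:R) *: t ^+ n.+1)).
    by apply: (is_derive_eq P'); rewrite /GRing.scale /= mulrA divfK // pnatr_eq0.
  by apply/funext => t; rewrite /GRing.scale /=; ring.
exists (Num.min d 1) => [|r]; first by rewrite lt_min d0 ltr01.
rewrite lt_min => /and3P[r0 rd r1].
have bnd t : 0 < t < r -> `|m t * g t - g 0 * t ^+ n| <= eps * t ^+ n.
  move=> /andP[t0 tr]; rewrite radial_weightE; last by apply/andP; split; lra.
  rewrite (_ : _ - _ = t ^+ n * (e t * g t - g 0)); last by ring.
  rewrite normrM ger0_norm ?exprn_ge0 ?(ltW t0) // mulrC ler_wpM2r //.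
    by rewrite exprn_ge0 ?ltW.
  by apply/ltW/Hd; rewrite subr0 gtr0_norm //; lra.
have DG t : 0 <= t <= r -> is_derive t 1 G (m t * g t).
  by move=> /andP[? ?]; apply: radial_fluxP.2; lra.
have z (k : R) : k * (0 ^+ n.+1 / n.+1%:R) = 0 by rewrite expr0n /= mul0r mulr0.
set rn := r ^+ n.+1 / n.+1%:R.
rewrite ler_norml; apply/andP; split.
  have := @le_of_derivative R (fun t => G t - (g 0 - eps) * (t ^+ n.+1 / n.+1%:R))
    (fun t => m t * g t - (g 0 - eps) * t ^+ n) 0 r (ltW r0).
  have DD t : 0 <= t <= r -> is_derive t 1
      (fun t => G t - (g 0 - eps) * (t ^+ n.+1 / n.+1%:R))
      (m t * g t - (g 0 - eps) * t ^+ n).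
    move=> t01; apply: is_deriveB; first exact: DG.
    by apply: D; apply: sub01; case/andP: t01 => -> /= ?; lra.
  rewrite z radial_fluxP.1 subrr => H.
  suff : 0 <= G r - (g 0 - eps) * rn by nra.
  apply: H => t tr.
  - by apply: DD; case/andP: tr => /ltW -> /ltW ->.
  - exact: is_derive_continuous (DD t tr).
  - by have := bnd t tr; rewrite ler_norml => /andP[+ _]; lra.
have := @le_of_derivative R (fun t => (g 0 + eps) * (t ^+ n.+1 / n.+1%:R) - G t)
  (fun t => (g 0 + eps) * t ^+ n - m t * g t) 0 r (ltW r0).
have DD t : 0 <= t <= r -> is_derive t 1
    (fun t => (g 0 + eps) * (t ^+ n.+1 / n.+1%:R) - G t)
    ((g 0 + eps) * t ^+ n - m t * g t).
  move=> t01; apply: is_deriveB; last exact: DG.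
  by apply: D; apply: sub01; case/andP: t01 => -> /= ?; lra.
rewrite z radial_fluxP.1 subrr => H.
suff : 0 <= (g 0 + eps) * rn - G r by nra.
apply: H => t tr.
- by apply: DD; case/andP: tr => /ltW -> /ltW ->.
- exact: is_derive_continuous (DD t tr).
- by have := bnd t tr; rewrite ler_norml => /andP[_ +]; lra.
Qed.

Let K_continuous r : 0 <= r <= 1 -> {for r, continuous K}.
Proof.
move=> /andP[]; rewrite le_eqVlt => /orP[/eqP <- _|r0 r1].
  apply/continuous_epsP => eps eps0.
  have [|d d0 H] := @flux_near0 (eps / 2); first by rewrite divr_gt0.
  exists d => // y; rewrite subr0 => yd; rewrite /K lexx.
  have [_|y0] := leP y 0; first by rewrite subrr normr0.
  rewrite (gtr0_norm y0) in yd.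
  have := H y; rewrite y0 yd => /(_ isT).
  have p0 : 0 < y ^+ n.+1 by rewrite exprn_gt0.
  have N1 : (1 : R) <= n.+1%:R by rewrite ler1n.
  have N0 : (0 : R) < n.+1%:R by rewrite ltr0n.
  rewrite (_ : G y - _ = y ^+ n.+1 * (G y / y ^+ n.+1 - g 0 / n.+1%:R)); last first.
    by field; rewrite addrC natr1 !gt_eqF.
  rewrite normrM (gtr0_norm p0) mulrA (mulrC (eps / 2)) -mulrA ler_pM2l //.
  move=> /le_lt_trans; apply; rewrite ltr_pdivrMr //.
  have : eps <= eps * n.+1%:R by rewrite ler_peMr // ltW.
  lra.
have C : {for r, continuous (fun s => G s / s ^+ n.+1)}.
  apply (@continuousM R _ G (fun s => (s ^+ n.+1)^-1)).
    by apply: is_derive_continuous (radial_fluxP.2 r _); lra.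
  apply: continuousV; first by rewrite gt_eqF // exprn_gt0.
  exact: exprn_continuous.
have E : \near r, G r / r ^+ n.+1 = K r.
  near=> s; rewrite /K leNgt; have -> // : 0 < s.
  by near: s; exact: lt_nbhsr.
exact: near_eq_continuous_for E C.
Unshelve. all: by end_near. Qed.

Lemma radial_slope_continuous r : 0 <= r <= 1 -> {for r, continuous V}.
Proof.
move=> r01; apply (@continuousM R _ K (fun s => (e s)^-1)); first exact: K_continuous.
apply: continuousV; first by rewrite gt_eqF // drift_exp_gt0.
exact: drift_exp_continuous.
Qed.

Lemma radial_slopeE r : 0 < r <= 1 -> r * V r = G r / m r.
Proof.
move=> /andP[r0 r1]; rewrite /radial_slope /K leNgt r0 /=.
rewrite radial_weightE ?(ltW r0) // exprS; field.
by rewrite !gt_eqF ?exprn_gt0 ?drift_exp_gt0.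
Qed.

Definition radial_remainder r : R := g r - n.+1%:R * V r - A * r ^+ 2 * q r * V r.
Notation Z := radial_remainder.

(** The equation itself: differentiating [G / (r ^+ n.+1 * e)] and using
    [G' = m * g] leaves no derivative of [q]. *)
Lemma is_derive_radial_slope r : 0 < r < 1 -> is_derive r 1 V (Z r / r).
Proof.
move=> r01; have /andP[r0 r1] := r01.
have e0' := drift_exp_gt0 r.
have DG : is_derive r 1 G (m r * g r) by apply: radial_fluxP.2; lra.
have DP : is_derive r 1 (fun s : R => s ^+ n.+1) (n.+1%:R * r ^+ n).
  split; first exact: exprn_derivable.
  by rewrite exp_derive /GRing.scale /= mulr1.
have DD : is_derive r 1 (fun s => s ^+ n.+1 * e s) _ :=
  is_deriveM DP (is_derive_drift_exp r01).
have nz : r ^+ n.+1 * e r != 0 by rewrite mulf_neq0 ?gt_eqF // exprn_gt0.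
have DV : is_derive r 1 (fun s => G s * (s ^+ n.+1 * e s)^-1) _ :=
  is_deriveM DG (@is_deriveV _ (fun s => s ^+ n.+1 * e s) r _ 1 nz DD).
have E : \near r, G r * (r ^+ n.+1 * e r)^-1 = V r.
  near=> s; rewrite /radial_slope /K leNgt.
  have s0 : 0 < s by near: s; exact: lt_nbhsr.
  by rewrite s0 /= invfM mulrA.
apply: (near_eq_is_derive E); apply: (is_derive_eq DV).
rewrite /radial_remainder /radial_slope /K leNgt r0 /=.
rewrite radial_weightE ?(ltW r0) ?(ltW r1) // /GRing.scale /= !(exprS r n).
set M := n.+1%:R; field.
by rewrite !gt_eqF ?exprn_gt0.
Unshelve. all: by end_near. Qed.

Lemma radial_slope0 : V 0 = g 0 / n.+1%:R.
Proof. by rewrite /radial_slope /K lexx e0 invr1 mulr1. Qed.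

Let w r := c r * V (c r).
Let cw : continuous w.
Proof.
move=> r; apply (@continuousM R _ c (V \o c)); first exact: cc.
apply: continuous_comp; first exact: cc.
exact: radial_slope_continuous.
Qed.
Let H := antiderivative w.
Let HP : H 0 = 0 /\ forall r, -1 < r < 2 -> is_derive r 1 H (w r).
Proof. exact: antiderivativeP. Qed.

Definition radial_solution r : R := H 1 - H (clamp 0 1 r).

Lemma radial_solution_continuous : continuous radial_solution.
Proof.
move=> r; apply (@continuousB R R _ (fun=> H 1) (H \o c)).
  exact: cst_continuous.
apply: continuous_comp; first exact: cc.
exact: is_derive_continuous (HP.2 _ (sub01 (c_itv r))).
Qed.

Lemma radial_solution1 : radial_solution 1 = 0.
Proof. by rewrite /radial_solution -/(c 1) c_id ?subrr // ler01 lexx. Qed.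

Lemma is_derive_radial_solution r : 0 < r < 1 ->
  is_derive r 1 radial_solution (r * - V r).
Proof.
move=> r01; have /andP[r0 r1] := r01.
have D : is_derive r 1 (fun s => H 1 - H s) (0 - w r).
  have DH : is_derive r 1 H (w r) by apply: HP.2; lra.
  exact: is_deriveB (is_derive_cst (H 1) r 1) DH.
have E s : 0 <= s <= 1 -> H 1 - H s = radial_solution s.
  by move=> s01; rewrite /radial_solution -/(c s) c_id.
apply: near_eq_is_derive (near01 r01 E) _; apply: (is_derive_eq D).
by rewrite sub0r /w c_id ?mulrN // !ltW.
Qed.

End Solve.

Let c1 : continuous (fun _ : R => 1 : R). Proof. exact: cst_continuous. Qed.

Lemma radial_weight_gt0 r : 0 < r <= 1 -> 0 < m r.
Proof.
move=> /andP[r0 r1]; rewrite radial_weightE ?(ltW r0) //.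
by rewrite mulr_gt0 ?drift_exp_gt0 // exprn_gt0.
Qed.

(** A bound on a combination of right-hand sides passes to the fluxes, from
    there to the slopes, and finally to the solutions. The coefficients [a] and
    [b] cover positivity, upper bounds and Lipschitz dependence at once. The
    constant [E], which controls the flux of the constant 1, is the only trace
    of the drift. *)
Lemma radial_comparison g1 g2 a b d E r :
  continuous g1 -> continuous g2 -> 0 <= d -> 0 <= E ->
  (forall t, 0 <= t <= 1 -> radial_flux (fun=> 1) t <= E * m t) ->
  (forall t, 0 <= t <= 1 -> a * g1 t + b * g2 t <= d) -> 0 <= r <= 1 ->
  a * radial_solution g1 r + b * radial_solution g2 r <= d * E.
Proof.
move=> cg1 cg2 d0 E0 HE Hg /andP[r0 r1].
have lin f1 f2 (x y k l t : R) : is_derive t 1 f1 x -> is_derive t 1 f2 y ->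
    is_derive t 1 (fun s => k * f1 s + l * f2 s) (k * x + l * y).
  by move=> D1 D2; exact: is_deriveD (is_deriveZ k D1) (is_deriveZ l D2).
have HG t : 0 <= t <= 1 ->
    a * radial_flux g1 t + b * radial_flux g2 t <= d * E * m t.
  move=> /andP[t0 t1]; pose F s :=
    d * radial_flux (fun=> 1) s + -1 * (a * radial_flux g1 s + b * radial_flux g2 s).
  have DF s : 0 <= s <= t -> is_derive s 1 F
      (d * (m s * 1) + -1 * (a * (m s * g1 s) + b * (m s * g2 s))).
    move=> /andP[s0 st].
    by apply lin; [|apply lin]; apply: (radial_fluxP _).2 => //; lra.
  have : F 0 <= F t.
    apply: (le_of_derivative t0 (df := fun s =>
      d * (m s * 1) + -1 * (a * (m s * g1 s) + b * (m s * g2 s)))).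
    - by move=> s /andP[s0 st]; apply: DF; apply/andP; split; lra.
    - by move=> s st; apply: is_derive_continuous (DF s st).
    move=> s /andP[s0 st].
    rewrite (_ : _ + _ = m s * (d - (a * g1 s + b * g2 s))); last by ring.
    rewrite mulr_ge0 ?radial_weight_ge0 // subr_ge0 Hg //.
    by apply/andP; split; lra.
  rewrite /F !(radial_fluxP _).1 //.
  have : d * radial_flux (fun=> 1) t <= d * (E * m t).
    by apply: ler_wpM2l => //; apply: HE; rewrite t0 t1.
  by rewrite mulrA; lra.
pose S s := d * E * s + 1 * (a * radial_solution g1 s + b * radial_solution g2 s).
have Sr : S r <= S 1.
  apply: (le_of_derivative r1 (df := fun s =>
    d * E * 1 + 1 * (a * (s * - radial_slope g1 s) + b * (s * - radial_slope g2 s)))).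
  - move=> s /andP[rs s1]; apply lin; first exact: is_derive_id.
    by apply lin; apply: is_derive_radial_solution => //; apply/andP; split; lra.
  - move=> s _; apply (@continuousD R R _ (fun s => d * E * s)
      (fun s => 1 * (a * radial_solution g1 s + b * radial_solution g2 s))).
      apply (@continuousM R _ (fun=> d * E) id); first exact: cst_continuous.
      exact: cvg_id.
    apply (@continuousM R _ (fun=> 1 : R)
      (fun s => a * radial_solution g1 s + b * radial_solution g2 s)).
      exact: cst_continuous.
    by apply (@continuousD R R _ (fun s => a * radial_solution g1 s)
        (fun s => b * radial_solution g2 s));
      [apply (@continuousM R _ (fun=> a) (radial_solution g1))
      |apply (@continuousM R _ (fun=> b) (radial_solution g2))];
      (exact: cst_continuous || exact: radial_solution_continuous).
  - move=> s /andP[rs s1]; have s01 : 0 < s <= 1 by apply/andP; split; lra.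
    have V1 := radial_slopeE g1 s01; have V2 := radial_slopeE g2 s01.
    have ms := radial_weight_gt0 s01.
    rewrite !mulrN V1 V2.
    rewrite (_ : _ + _ = (d * E * m s -
      (a * radial_flux g1 s + b * radial_flux g2 s)) / m s); last first.
      by field; rewrite gt_eqF.
    by rewrite divr_ge0 ?(ltW ms) // subr_ge0 HG //; apply/andP; split; lra.
rewrite /S !radial_solution1 // !mulr0 in Sr.
have := mulr_ge0 (mulr_ge0 d0 E0) r0; lra.
Qed.

Lemma radial_flux_increment r s : 0 <= r -> r <= s -> s <= 1 ->
  radial_flux (fun=> 1) s <= radial_flux (fun=> 1) r + (s - r) * m s.
Proof.
move=> r0; rewrite le_eqVlt => /orP[/eqP <- _|rs s1].
  by rewrite subrr mul0r addr0.
have D t : 0 <= t <= 1 -> is_derive t 1 (radial_flux (fun=> 1)) (m t * 1).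
  by move=> /sub01; exact: (radial_fluxP c1).2.
have [t|t|t /andP[rt ts]] :=
  @mean_value R (radial_flux (fun=> 1)) (fun t => m t * 1) r s rs.
- by move=> /andP[? ?]; apply: D; apply/andP; split; lra.
- by move=> /andP[? ?]; apply: is_derive_continuous (D t _); apply/andP; split; lra.
move=> H; rewrite -lerBlDl H mulr1 mulrC ler_wpM2l ?subr_ge0 ?(ltW rs) //.
by apply: radial_weight_mono => //; lra.
Qed.

Lemma radial_flux_le r : 0 <= r <= 1 -> radial_flux (fun=> 1) r <= r * m r.
Proof.
move=> /andP[r0 r1]; have := radial_flux_increment (lexx 0) r0 r1.
by rewrite (radial_fluxP c1).1 add0r subr0.
Qed.

(** Mass within distance [d] of [r] contributes at most [d * m r]; mass further
    inside is damped by the growth of the potential over the length [d]. *)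
Lemma radial_flux_decay d k r : 0 < d ->
  (forall s, d <= s <= 1 -> k <= Q s - Q (s - d)) -> 0 <= r <= 1 ->
  radial_flux (fun=> 1) r <= (d + expR (- (A * k))) * m r.
Proof.
move=> d0 Hk /andP[r0 r1]; have mr := radial_weight_ge0 r.
have [rd|dr] := leP r d.
  apply: (le_trans (radial_flux_le _)); first by rewrite r0.
  by rewrite ler_wpM2r // (le_trans rd) // lerDl expR_ge0.
have rd0 : 0 <= r - d by lra.
have rdr : r - d <= r by lra.
apply: (le_trans (radial_flux_increment rd0 rdr r1)).
rewrite opprB addrCA subrr addr0 addrC mulrDl lerD2l.
apply: (le_trans (radial_flux_le _)); first by rewrite rd0 /=; lra.
apply: (@le_trans _ _ (m (r - d))).
  by rewrite ler_piMl ?radial_weight_ge0 //; lra.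
apply: (le_trans (radial_weight_ratio rd0 rdr r1)).
rewrite ler_wpM2r // ler_expR lerN2 ler_wpM2l // Hk //.
by rewrite (ltW dr).
Qed.

Section OnTheBall.
Variable rho : R -> R.
Hypothesis rhoq : forall r, 0 <= r < 1 -> rho r = q r.
Variable g : R -> R.
Hypothesis cg : continuous g.

Notation u := (fun x : 'rV[R]_n.+1 => radial_solution g (enorm x)).

Let dU r : 0 < r < 1 -> is_derive r 1 (radial_solution g) (r * - radial_slope g r).
Proof. exact: is_derive_radial_solution. Qed.

Let dV r : 0 < r < 1 ->
  is_derive r 1 (fun s => - radial_slope g s) (- radial_remainder g r / r).
Proof.
move=> r01; rewrite mulNr; exact: is_deriveN (is_derive_radial_slope cg r01).
Qed.

Let cU0 : {for (0 : R), continuous (radial_solution g)}.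
Proof. exact: radial_solution_continuous. Qed.

Let cV r : 0 <= r < 1 -> {for r, continuous (fun s => - radial_slope g s)}.
Proof.
move=> /andP[r0 r1]; apply: continuousN; apply: radial_slope_continuous => //.
by rewrite r0 ltW.
Qed.

Let cZ r : 0 <= r < 1 -> {for r, continuous (fun s => - radial_remainder g s)}.
Proof.
move=> /andP[r0 r1]; apply: continuousN.
have CV : {for r, continuous (radial_slope g)}.
  by apply: radial_slope_continuous => //; rewrite r0 ltW.
apply (@continuousB R R _ (fun s => g s - n.+1%:R * radial_slope g s)
  (fun s => A * s ^+ 2 * q s * radial_slope g s)).
  apply (@continuousB R R _ g (fun s => n.+1%:R * radial_slope g s)); first exact: cg.
  apply (@continuousM R _ (fun=> n.+1%:R) (radial_slope g)); last exact: CV.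
  exact: cst_continuous.
apply (@continuousM R _ (fun s => A * s ^+ 2 * q s) (radial_slope g)); last exact: CV.
apply (@continuousM R _ (fun s => A * s ^+ 2) q); last exact: cq.
apply (@continuousM R _ (fun=> A) (fun s => s ^+ 2)); first exact: cst_continuous.
exact: exprn_continuous.
Qed.

Let Z0 : - radial_remainder g 0 = 0.
Proof.
rewrite /radial_remainder radial_slope0 expr2 !mulr0 !mul0r subr0.
by rewrite mulrC divfK ?pnatr_eq0 // subrr oppr0.
Qed.

Lemma radial_solution_class_C2 : class_C 2 unit_ball u.
Proof. exact: radial_class_C2 dU dV cU0 cV cZ Z0. Qed.

Lemma radial_solution_Lop x : unit_ball x -> Lop rho A u x = g (enorm x).
Proof.
move=> x1; rewrite (radial_Lop dU dV cU0 cV Z0) // /radial_remainder.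
rewrite rhoq; first by ring.
by rewrite enorm_ge0.
Qed.

Lemma radial_solution_ball_continuous :
  {within closed_unit_ball, continuous u}.
Proof.
apply: continuous_subspaceT => x.
apply: (@continuous_comp _ _ _ (@enorm R n.+1)); first exact: enorm_continuous.
exact: radial_solution_continuous.
Qed.

Lemma radial_solution_sphere x : unit_sphere x -> u x = 0.
Proof.
move=> x1; have E : enorm x = 1 by exact: x1.
by rewrite /= E radial_solution1.
Qed.

End OnTheBall.

End RadialSolver.

(** * Radial solutions of the nonlinear problem *)

Section FixedPoint.
Context {R : realType}.

(** Adding and subtracting the tail [x k] of the geometric series turns [a]
    into a nonincreasing and a nondecreasing sequence, with the limit between
    them. *)
Lemma geometric_limit (a : nat -> R) (C : R) :
  (forall k, `|a k.+1 - a k| <= C * (1 / 2) ^+ k) ->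
  exists L, forall k, `|L - a k| <= 2 * C * (1 / 2) ^+ k.
Proof.
move=> Ha; pose x k := 2 * C * (1 / 2) ^+ k.
have xS k : x k.+1 = x k - C * (1 / 2) ^+ k by rewrite /x exprS; field.
have C0 : 0 <= C by have := le_trans (normr_ge0 _) (Ha 0%N); rewrite expr0 mulr1.
have x0 k : 0 <= x k by rewrite !mulr_ge0 // exprn_ge0.
have lo k j : a k - x k <= a (k + j)%N - x (k + j)%N.
  elim: j => [|j IH]; first by rewrite addn0.
  apply: (le_trans IH); rewrite addnS xS.
  by have := Ha (k + j)%N; rewrite ler_norml => /andP[? ?]; lra.
have hi k j : a (k + j)%N + x (k + j)%N <= a k + x k.
  elim: j => [|j IH]; first by rewrite addn0.
  apply: le_trans IH; rewrite addnS xS.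
  by have := Ha (k + j)%N; rewrite ler_norml => /andP[? ?]; lra.
have lohi j k : a j - x j <= a k + x k.
  have := lo j k; have := hi k j; rewrite addnC; have := x0 (j + k)%N; lra.
pose S := [set y | exists k, y = a k - x k].
have S0 : S !=set0 by exists (a 0%N - x 0%N), 0%N.
exists (sup S) => k; rewrite ler_norml; apply/andP; split.
  have : a k - x k <= sup S.
    apply: ub_le_sup; last by exists k.
    by exists (a 0%N + x 0%N) => _ [j ->]; exact: lohi.
  by rewrite -/(x k); lra.
have : sup S <= a k + x k by apply: ge_sup => // _ [j ->]; exact: lohi.
by rewrite -/(x k); lra.
Qed.

Lemma half_power_small (C eps : R) : 0 <= C -> 0 < eps ->
  exists k : nat, C * (1 / 2) ^+ k < eps.
Proof.
move=> C0 eps0; exists (Num.bound (C / eps)).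
set k := Num.bound _.
have kC : C / eps < k%:R by apply: archi_boundP; rewrite divr_ge0 // ltW.
have k2 : k%:R < (2 : R) ^+ k by rewrite -natrX ltr_nat ltn_expl.
rewrite div1r exprVn ltr_pdivrMr ?exprn_gt0 // mulrC -ltr_pdivrMr //.
exact: lt_trans k2.
Qed.

Variables (n : nat) (q : R -> R) (A : R).
Hypothesis cq : continuous q.
Variables (f : R -> R) (t0 B M lam E : R).
Hypothesis t00 : 0 < t0.
Hypothesis fB : forall t, 0 <= t <= t0 -> 0 <= f t <= B.
Hypothesis M0 : 0 <= M.
Hypothesis fM : forall s t, 0 <= s <= t0 -> 0 <= t <= t0 ->
  `|f s - f t| <= M * `|s - t|.
Hypothesis lam0 : 0 < lam.
Hypothesis E0 : 0 <= E.
Hypothesis fluxE : forall t : R, 0 <= t <= 1 ->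
  radial_flux n q A (fun=> 1) t <= E * radial_weight n q A t.
Hypothesis lamB : lam * B * E <= t0.
Hypothesis lamM : lam * M * E <= 1 / 2.

(* truncating the nonlinearity makes the solution map T defined on all
   continuous functions; its values stay where the truncation is inactive *)
Let fc t := lam * f (clamp 0 t0 t).
Let T (v : R -> R) : R -> R := radial_solution n q A (fc \o v).

Let cl t : 0 <= clamp 0 t0 t <= t0. Proof. exact/clamp_itv/ltW. Qed.

Let fc_lip s t : `|fc s - fc t| <= lam * M * `|s - t|.
Proof.
rewrite /fc -mulrBr normrM gtr0_norm // -mulrA ler_pM2l //.
apply: (le_trans (fM (cl s) (cl t))); rewrite ler_wpM2l //.
exact/clamp_dist/ltW.
Qed.

Let fc_itv t : 0 <= fc t <= lam * B.
Proof.
have /andP[f0 f1] := fB (cl t).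
by rewrite /fc mulr_ge0 ?(ltW lam0) // ler_pM2l.
Qed.

Let fc_continuous : continuous fc.
Proof.
move=> s; apply/continuous_epsP => e e0; exists (e / (lam * M + 1)).
  by rewrite divr_gt0 // ltr_wpDl // mulr_ge0 // ltW.
move=> t; rewrite ltr_pdivlMr; last by rewrite ltr_wpDl // mulr_ge0 // ltW.
move=> H; apply: le_lt_trans (fc_lip t s) _; apply: le_lt_trans H.
by rewrite mulrC ler_wpM2l // lerDl.
Qed.

Let cT (v : R -> R) : continuous v -> continuous (T v).
Proof.
move=> cv; apply: radial_solution_continuous => // r.
by apply: continuous_comp; [exact: cv|exact: fc_continuous].
Qed.

Let fcv (v : R -> R) : continuous v -> continuous (fc \o v).
Proof. by move=> cv r; apply: continuous_comp; [exact: cv|exact: fc_continuous]. Qed.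

Let T_clamp (v : R -> R) (r : R) : T v r = T v (clamp 0 1 r).
Proof. by rewrite /T /radial_solution (clamp_id (clamp_itv _ _)). Qed.

Let T_itv (v : R -> R) (r : R) : continuous v -> 0 <= T v r <= t0.
Proof.
move=> cv; rewrite T_clamp; have r01 := @clamp_itv R 0 1 r ler01.
have cg := fcv cv; apply/andP; split.
  have := @radial_comparison R n q A cq _ _ (-1) 0 0 E _ cg cg (lexx 0) E0 fluxE.
  move=> /(_ (clamp 0 1 r)); rewrite !mul0r addr0 mulN1r oppr_le0; apply => //.
  by move=> t _; rewrite mul0r addr0 mulN1r oppr_le0; case/andP: (fc_itv (v t)).
have LB : 0 <= lam * B by case/andP: (fc_itv 0); exact: le_trans.
have := @radial_comparison R n q A cq _ _ 1 0 (lam * B) E _ cg cg LB E0 fluxE.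
move=> /(_ (clamp 0 1 r)); rewrite mul0r addr0 mul1r => H.
apply: le_trans lamB; apply: H => // t _.
by rewrite mul0r addr0 mul1r; case/andP: (fc_itv (v t)).
Qed.

Let T_contract (v1 v2 : R -> R) (d r : R) : continuous v1 -> continuous v2 -> 0 <= d ->
  (forall s, `|v1 s - v2 s| <= d) -> `|T v1 r - T v2 r| <= d / 2.
Proof.
move=> cv1 cv2 d0 Hd; rewrite !(T_clamp _ r).
have r01 := @clamp_itv R 0 1 r ler01.
have D0 : 0 <= lam * M * d by rewrite !mulr_ge0 // ltW.
have bd t : `|fc (v1 t) - fc (v2 t)| <= lam * M * d.
  by apply: (le_trans (fc_lip _ _)); rewrite ler_wpM2l // mulr_ge0 // ltW.
have DE : lam * M * d * E <= d / 2 by rewrite mulrAC (le_trans (ler_wpM2r d0 lamM)) //; lra.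
rewrite ler_norml; apply/andP; split.
  have := @radial_comparison R n q A cq _ _ (-1) 1 (lam * M * d) E
    (clamp 0 1 r) (fcv cv1) (fcv cv2) D0 E0 fluxE.
  rewrite -!/(T _) => H.
  have : -1 * T v1 (clamp 0 1 r) + 1 * T v2 (clamp 0 1 r) <= lam * M * d * E.
    apply: H => // t _; have := bd t; rewrite ler_norml => /andP[? ?] /=; lra.
  lra.
have := @radial_comparison R n q A cq _ _ 1 (-1) (lam * M * d) E
  (clamp 0 1 r) (fcv cv1) (fcv cv2) D0 E0 fluxE.
rewrite -!/(T _) => H.
have : 1 * T v1 (clamp 0 1 r) + -1 * T v2 (clamp 0 1 r) <= lam * M * d * E.
  apply: H => // t _; have := bd t; rewrite ler_norml => /andP[? ?] /=; lra.
lra.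
Qed.

(** The map [T] halves uniform distances because [lam * M * E <= 1 / 2], and
    takes its values between 0 and [t0] because [lam * B * E <= t0]. *)
Lemma radial_fixed_point : exists v : R -> R,
  [/\ continuous v, (forall r, 0 <= v r <= t0) &
      v = radial_solution n q A (fun r => lam * f (v r))].
Proof.
pose a k := iter k T (fun=> 0).
have ca k : continuous (a k).
  by elim: k => [|k IH]; [exact: cst_continuous|exact: cT].
have step k r : `|a k.+1 r - a k r| <= t0 * (1 / 2) ^+ k.
  elim: k r => [|k IH] r.
    rewrite expr0 mulr1 subr0 /a /=.
    by have /andP[? ?] := T_itv r (ca 0%N); rewrite ger0_norm.
  have := @T_contract (a k.+1) (a k) (t0 * (1 / 2) ^+ k) r (ca _) (ca _) _ IH.
  rewrite exprS mulrCA [1 / 2 * _]mulrC mul1r; apply.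
  by rewrite mulr_ge0 ?exprn_ge0 // ltW.
have /choice[v Hv] : forall r, exists L, forall k,
    `|L - a k r| <= 2 * t0 * (1 / 2) ^+ k.
  by move=> r; exact: geometric_limit.
have t2 : 0 <= 2 * t0 by rewrite mulr_ge0 // ltW.
have cv : continuous v.
  move=> r; apply/continuous_epsP => e e0.
  have e3 : 0 < e / 3 by rewrite divr_gt0.
  have [k Hk] := half_power_small t2 e3.
  have [d d0 Hd] := (continuous_epsP _ _).1 (ca k r) _ e3.
  exists d => // s /Hd; have := Hv r k; have := Hv s k.
  rewrite !ler_norml !ltr_norml => /andP[? ?] /andP[? ?] /andP[? ?].
  by apply/andP; split; lra.
have Tv : T v = v.
  apply/funext => r; apply/eqP; rewrite -subr_eq0 -normr_le0.
  apply/ler_addgt0Pl => e e0; rewrite addr0.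
  have e2 : 0 < e / 2 by rewrite divr_gt0.
  have [k Hk] := half_power_small t2 e2.
  have p0 : 0 <= 2 * t0 * (1 / 2) ^+ k by rewrite mulr_ge0 // exprn_ge0.
  have := @T_contract v (a k) _ r cv (ca k) p0 (fun s => Hv s k).
  have := Hv r k.+1; rewrite exprS -/(a k.+1).
  have -> : T (a k) r = a k.+1 r by [].
  rewrite !ler_norml => /andP[? ?] /andP[? ?]; apply/andP; split; lra.
exists v; split => //; first by move=> r; rewrite -Tv; exact: T_itv.
rewrite -{1}Tv /T; congr radial_solution; apply/funext => r.
rewrite /fc /= clamp_id // -Tv; exact: T_itv.
Qed.

Lemma radial_classical_solution (rho : R -> R) :
  (forall r, 0 <= r < 1 -> rho r = q r) ->
  exists u : 'rV[R]_n.+1 -> R,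
  [/\ class_C 2 unit_ball u, {within closed_unit_ball, continuous u},
      (forall x, 0 <= u x <= t0),
      (forall x, unit_ball x -> Lop rho A u x = lam * f (u x)) &
      (forall x, unit_sphere x -> u x = 0)].
Proof.
move=> rhoq; have [v [cv vt0 Ev]] := radial_fixed_point.
have cg : continuous (fun r => lam * f (v r)).
  rewrite (_ : (fun r => _) = fc \o v); first exact: fcv.
  by apply/funext => r; rewrite /fc /= clamp_id.
have Eu : (fun x : 'rV[R]_n.+1 => v (enorm x)) =
    fun x => radial_solution n q A (fun r => lam * f (v r)) (enorm x).
  by apply/funext => x; exact: (congr1 (fun h => h (enorm x)) Ev).
exists (fun x => v (enorm x)); split.
- by rewrite Eu; exact: radial_solution_class_C2.
- by rewrite Eu; exact: radial_solution_ball_continuous.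
- by move=> x; exact: vt0.
- by move=> x x1; rewrite Eu (radial_solution_Lop A cq rhoq cg).
- move=> x x1; change ((fun x : 'rV[R]_n.+1 => v (enorm x)) x = 0).
  by rewrite Eu; exact: radial_solution_sphere.
Qed.

End FixedPoint.

(** * Consequences of the hypotheses on the data *)

Section Nonlinearities.
Context {R : realType}.
Variables (a : \bar R) (f : R -> R).
Hypothesis nl : nonlinearity a f.

Let itv_nldom t : 0 <= t <= 3 / 4 -> nldom a t.
Proof.
move=> /andP[t0 t34]; split => //.
by case: nl => _ [[-> _]|[-> _]]; rewrite ?ltry // lte_fin; lra.
Qed.

Lemma nonlinearity_mono s t : nldom a s -> nldom a t -> s <= t -> f s <= f t.
Proof.
case: nl => -[_ inc _ _ _] _ ds dt; rewrite le_eqVlt => /orP[/eqP -> //|st].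
by apply/ltW/inc; rewrite ?inE.
Qed.

Lemma nonlinearity_gt0 t : nldom a t -> 0 < f t.
Proof.
move=> dt; case: (nl) => -[_ _ _ [_ f0] _] _.
apply: (lt_le_trans f0); apply: nonlinearity_mono => //; last by case: dt.
by apply: itv_nldom; rewrite lexx; lra.
Qed.

(** For regular [f] this follows from superlinear growth, for singular [f] from
    the boundedness of the domain. *)
Lemma nonlinearity_linear_bound :
  exists2 c, 0 < c & forall t, nldom a t -> c * t <= f t.
Proof.
have d0 : nldom a 0 by apply: itv_nldom; rewrite lexx; lra.
have f0 := nonlinearity_gt0 d0.
have fge t : nldom a t -> f 0 <= f t.
  by move=> dt; apply: nonlinearity_mono => //; case: dt.
case: (nl) => _ [[_ /cvgryPge/(_ 1)]|[a1 _]]; last first.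
  exists (f 0) => // t dt; apply: le_trans (fge _ dt).
  by case: dt => t0; rewrite a1 lte_fin => t1; rewrite ler_piMr // ltW.
move=> [T [_ HT]]; have T0 : 0 < Num.max T 0 + 1 by rewrite ltr_wpDl // le_max lexx orbT.
exists (Num.min 1 (f 0 / (Num.max T 0 + 1))) => [|t dt].
  by rewrite lt_min ltr01 divr_gt0.
have [t0 _] := dt.
have [tT|tT] := ltP (Num.max T 0) t.
  have tpos : 0 < t by apply: le_lt_trans tT; rewrite le_max lexx orbT.
  have := HT t (le_lt_trans _ tT); rewrite le_max lexx => /(_ isT).
  rewrite ler_pdivlMr // => H; apply: le_trans H.
  by rewrite ler_wpM2r // ge_min lexx.
apply: le_trans (fge _ dt); apply: (@le_trans _ _ (f 0 / (Num.max T 0 + 1) * t)).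
  by rewrite ler_wpM2r // ge_min lexx orbT.
rewrite mulrAC ler_pdivrMr // ler_pM2l //; lra.
Qed.

(** Slopes of a convex function on [0, 1/2] are bounded by the slope of a chord
    ending at a larger point of the domain, here 3/4. *)
Lemma nonlinearity_lipschitz : exists2 M, 0 <= M &
  forall s t, 0 <= s <= 1 / 2 -> 0 <= t <= 1 / 2 -> `|f s - f t| <= M * `|s - t|.
Proof.
pose t1 : R := 3 / 4.
have D t : 0 <= t <= 1 / 2 -> nldom a t.
  by move=> /andP[? ?]; apply: itv_nldom; apply/andP; split; lra.
have d0 : nldom a 0 by apply: itv_nldom; rewrite lexx; lra.
have d1 : nldom a t1 by apply: itv_nldom; rewrite /t1 lexx andbT; lra.
have f01 : f 0 <= f t1 by apply: nonlinearity_mono => //; rewrite /t1; lra.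
exists (4 * (f t1 - f 0)); first by rewrite mulr_ge0 // subr_ge0.
have key s t : 0 <= s <= 1 / 2 -> 0 <= t <= 1 / 2 -> s <= t ->
    `|f s - f t| <= 4 * (f t1 - f 0) * `|s - t|.
  move=> s01 t01 st.
  have fst := nonlinearity_mono (D _ s01) (D _ t01) st.
  have f0s : f 0 <= f s by apply: nonlinearity_mono => //; [exact: D|case/andP: s01].
  have [s0 s12] := andP s01; have [_ t12] := andP t01.
  have g0 : 1 / 4 <= t1 - s by rewrite /t1; lra.
  have gp : 0 < t1 - s by lra.
  have p0 : 0 <= (t1 - t) / (t1 - s) by rewrite divr_ge0 //; rewrite /t1; lra.
  have p1 : (t1 - t) / (t1 - s) <= 1 by rewrite ler_pdivrMr //; lra.
  have := nl => -[[_ _ cvx _ _] _].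
  have H : f (conv (Itv01 p0 p1) (s : R^o) (t1 : R^o)) <=
      conv (Itv01 p0 p1) (f s : R^o) (f t1 : R^o).
    by apply: cvx; rewrite inE //; exact: D.
  have E : conv (Itv01 p0 p1) (s : R^o) (t1 : R^o) = t.
    by rewrite convRE /unstable.onem /=; field; rewrite gt_eqF.
  rewrite E convRE /= in H.
  have : f t - f s <= (t - s) / (t1 - s) * (f t1 - f s).
    apply: (le_trans (lerB H (lexx (f s)))); rewrite le_eqVlt; apply/orP; left.
    by apply/eqP; rewrite /unstable.onem; field; rewrite gt_eqF.
  rewrite distrC ger0_norm ?subr_ge0 // distrC ger0_norm ?subr_ge0 // => H1.
  apply: (le_trans H1); rewrite mulrAC [leRHS]mulrC ler_pdivrMr //.
  have A1 : 0 <= t - s by lra.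
  have A2 : 0 <= f t1 - f 0 by lra.
  have A3 : (t - s) * (f t1 - f s) <= (t - s) * (f t1 - f 0).
    by apply: ler_wpM2l => //; lra.
  have := mulr_ge0 A1 A2; nra.
move=> s t s01 t01; case/orP: (le_total s t) => st; first exact: key.
by rewrite distrC [`|s - t|]distrC; exact: key.
Qed.

Lemma half_lt_domain : ((1 / 2)%:E < a)%E.
Proof. by have [] : nldom a (1 / 2) by apply: itv_nldom; apply/andP; split; lra. Qed.

End Nonlinearities.

Section Coefficient.
Context {R : realType} {N : nat}.
Variable rho : R -> R.
Hypothesis adm : admissible_rho N rho.

Lemma admissible_continuous : continuous (rho \o clamp 0 1).
Proof.
case: adm => -[U [g [oU sU sg E]]] _ r.
have -> : rho \o clamp 0 1 = (g : R -> R) \o clamp 0 1.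
  by apply/funext => s /=; apply: E; rewrite inE /= in_itv /= clamp_itv.
apply: continuous_comp; first exact/clamp_continuous/ler01.
apply: (sg 0%N [::] _ _ _).1 => //; apply: sU.
by rewrite /= in_itv /= clamp_itv.
Qed.

Lemma negative_on_subinterval : (exists x0, 0 <= x0 <= 1 /\ rho x0 < 0) ->
  exists al be d, [/\ 0 < al, al < be, be < 1, 0 < d &
    forall r, al < r < be -> rho r <= - d].
Proof.
move=> [x0 [x01 rx0]].
have d0 : 0 < - rho x0 / 2 by lra.
have [e e0 He] := (continuous_epsP _ _).1 (@admissible_continuous x0) _ d0.
have /andP[x00 x01'] := x01.
pose e' := Num.min e (1 / 4).
have e'e : e' <= e by rewrite ge_min lexx.
have e'q : e' <= 1 / 4 by rewrite ge_min lexx orbT.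
have e'0 : 0 < e' by rewrite lt_min e0 /=; lra.
have He' r : 0 <= r <= 1 -> `|r - x0| < e -> rho r <= - (- rho x0 / 2).
  move=> r01 /He; rewrite /= !clamp_id // ltr_norml => /andP[_ ?]; lra.
have [xh|xh] := leP x0 (1 / 2).
  exists (x0 + e' / 4), (x0 + e' / 2), (- rho x0 / 2); split => //; try lra.
  move=> r /andP[r1 r2]; apply: He'; first by apply/andP; split; lra.
  by rewrite ltr_norml; apply/andP; split; lra.
exists (x0 - e' / 2), (x0 - e' / 4), (- rho x0 / 2); split => //; try lra.
move=> r /andP[r1 r2]; apply: He'; first by apply/andP; split; lra.
by rewrite ltr_norml; apply/andP; split; lra.
Qed.

Lemma zero_on_subinterval :
  (exists I, nondegenerate_subinterval I /\ forall r, I r -> rho r = 0) ->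
  exists al be, [/\ 0 < al, al < be, be < 1 & forall r, al < r < be -> rho r = 0].
Proof.
move=> [I [[itvI I01 [x [y [Ix Iy xy]]]] rI]].
have := I01 _ Ix; rewrite /= in_itv /= => /andP[x0 x1].
have := I01 _ Iy; rewrite /= in_itv /= => /andP[y0 y1].
exists ((2 * x + y) / 3), ((x + 2 * y) / 3); split; try lra.
move=> r /andP[r1 r2]; apply/rI/(itvI _ _ Ix Iy).
by apply/andP; split; lra.
Qed.

Section StrictlyPositiveDrift.
Hypothesis rho0 : forall r, 0 <= r <= 1 -> 0 <= rho r.
Hypothesis rhoI : forall I : set R, nondegenerate_subinterval I ->
  ~ (forall r, I r -> rho r = 0).

Let q := rho \o clamp 0 1.
Let cq : continuous q. Proof. exact: admissible_continuous. Qed.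
Let q0 (r : R) : 0 <= r <= 1 -> 0 <= q r.
Proof. by move=> r01; rewrite /q /= clamp_id // rho0. Qed.

(** If the potential took equal values at [r] and [s] it would be constant
    between them, and [rho] would vanish there. *)
Lemma drift_potential_lt (r s : R) : 0 <= r -> r < s -> s <= 1 ->
  drift_potential q r < drift_potential q s.
Proof.
move=> r0 rs s1; rewrite lt_neqAle; apply/andP; split; last first.
  by apply: drift_potential_mono => //; exact: ltW.
apply/negP => /eqP Q.
have Qc t : r < t < s -> drift_potential q t = drift_potential q r.
  move=> /andP[rt ts]; apply/eqP; rewrite eq_le; apply/andP; split.
    by rewrite Q; apply: drift_potential_mono => //; lra.
  by apply: drift_potential_mono => //; lra.
apply: (rhoI (I := [set t | r < t < s])).
  split.
  - move=> x y /= /andP[? ?] /andP[? ?] z /andP[? ?]; apply/andP; split; lra.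
  - by move=> x /= /andP[? ?]; rewrite in_itv /=; apply/andP; split; lra.
  exists ((2 * r + s) / 3), ((r + 2 * s) / 3) => /=.
  by split; [apply/andP; split| apply/andP; split|]; lra.
move=> t /= /andP[rt ts].
have D : is_derive t 1 (drift_potential q) (t * q t).
  by apply: (drift_potentialP cq).2; apply/andP; split; lra.
have C : is_derive t 1 (drift_potential q) 0.
  apply: (near_eq_is_derive (f := cst (drift_potential q r))).
  near=> z; rewrite /= Qc //; apply/andP; split; near: z.
    exact: lt_nbhsr.
  exact: lt_nbhsl.
have := is_derive_unique D C; rewrite /q /= clamp_id; last by apply/andP; split; lra.
by move/eqP; rewrite mulf_eq0 gt_eqF /= ?(le_lt_trans r0) // => /eqP.
Unshelve. all: by end_near. Qed.

(** By compactness the potential gains at least a fixed amount over every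
    interval of length [d], so [radial_flux_decay] gives a bound that tends to
    [d] as [A] grows. *)
Lemma flux_small_of_large_drift (n : nat) (eta : R) : 0 < eta ->
  exists2 A0, 0 <= A0 & forall A, A0 <= A -> forall t, 0 <= t <= 1 ->
    radial_flux n q A (fun=> 1) t <= eta * radial_weight n q A t.
Proof.
move=> eta0; pose d := Num.min (eta / 2) (1 / 2).
have d0 : 0 < d by rewrite lt_min !divr_gt0.
have d1 : d <= 1 / 2 by rewrite ge_min lexx orbT.
have de : d <= eta / 2 by rewrite ge_min lexx.
pose F s := drift_potential q s - drift_potential q (s - d).
have CQ s : -1 < s < 2 -> {for s, continuous (drift_potential q)}.
  by move=> /((drift_potentialP cq).2 _); exact: is_derive_continuous.
have CF : {within `[d, 1], continuous F}.
  apply: continuous_in_subspaceT => s; rewrite inE /= in_itv /= => /andP[ds s1].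
  apply (@continuousB R R _ (drift_potential q) (drift_potential q \o (fun s => s - d))).
    by apply: CQ; apply/andP; split; lra.
  apply: continuous_comp.
    apply (@continuousB R R _ id (fun=> d)); first exact: cvg_id.
    exact: cst_continuous.
  by apply: CQ; apply/andP; split; lra.
have d1' : d <= 1 by lra.
have [s0] := EVT_min d1' CF; rewrite in_itv /= => /andP[ds0 s01] Hmin.
have k0 : 0 < F s0 by rewrite /F subr_gt0; apply: drift_potential_lt; lra.
exists (2 / (eta * F s0)); first by rewrite divr_ge0 // mulr_ge0 // ltW.
move=> A HA t t01.
have A0 : 0 <= A by apply: le_trans HA; rewrite divr_ge0 // mulr_ge0 // ltW.
have Hk s : d <= s <= 1 -> F s0 <= drift_potential q s - drift_potential q (s - d).
  by move=> s01'; apply: Hmin; rewrite in_itv.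
apply: (le_trans (radial_flux_decay n cq q0 A0 d0 Hk t01)).
rewrite ler_wpM2r ?radial_weight_ge0 //.
have : expR (- (A * F s0)) <= eta / 2.
  rewrite expRN -[leRHS]invrK lef_pV2 ?posrE ?expR_gt0 ?invr_gt0 ?divr_gt0 //.
  apply: le_trans (expR_ge1Dx _).
  rewrite invf_div; rewrite ler_pdivrMr in HA; last by rewrite mulr_gt0.
  have : 2 / eta <= A * F s0 by rewrite ler_pdivrMr //; lra.
  lra.
lra.
Qed.

End StrictlyPositiveDrift.

End Coefficient.

(** * Bounds at a fixed drift strength *)

Section ExtremalParameter.
Context {R : realType} {N : nat}.
Variables (rho : R -> R) (A : R) (a : \bar R) (f : R -> R).
Implicit Types (lambda kappa : R).

Lemma extremal_le kappa lambdastar : 0 <= kappa ->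
  is_extremal_parameter N rho A a f lambdastar ->
  (forall lambda (u : 'rV[R]_N -> R), 0 < lambda ->
    is_classical_solution rho A a f lambda u -> lambda <= kappa) ->
  lambdastar <= kappa.
Proof.
move=> k0 [l0 ex _] H; rewrite leNgt; apply/negP => kl.
have [|u Su] := ex ((kappa + lambdastar) / 2); first by apply/andP; split; lra.
have lpos : 0 < (kappa + lambdastar) / 2 by lra.
have := H _ _ lpos Su; lra.
Qed.

Lemma extremal_ge lambda lambdastar :
  is_extremal_parameter N rho A a f lambdastar ->
  (exists u : 'rV[R]_N -> R, is_classical_solution rho A a f lambda u) ->
  lambda <= lambdastar.
Proof.
by move=> [_ _ nex] ex; rewrite leNgt; apply/negP => /nex; apply.
Qed.

End ExtremalParameter.

Section Upper.
Context {R : realType} {N : nat}.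
Variables (rho : R -> R) (A al be K : R).
Hypotheses (al0 : 0 < al) (albe : al < be) (be1 : be < 1) (K0 : 0 < K).

Lemma torsion_ge_of_barrier (psi : 'rV[R]_N -> R) : is_torsion rho A psi ->
  (forall x : 'rV[R]_N, unit_ball x -> Lop rho A (barrier al be K) x <= 1) ->
  K <= sup_ball psi.
Proof.
move=> tor HL; rewrite -(barrier_center (N := N) K al0 albe).
apply: (torsion_ge_barrier tor be1) => //.
- exact: barrier_class_C2.
- by move=> x; exact: barrier_outside.
- by rewrite barrier_center.
Qed.

Lemma extremal_le_of_barrier (a : \bar R) (f : R -> R) c kappa lambdastar :
  nonlinearity a f -> 0 < c -> (forall t, nldom a t -> c * t <= f t) -> 0 <= kappa ->
  is_extremal_parameter N rho A a f lambdastar ->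
  (forall x : 'rV[R]_N, unit_ball x ->
    Lop rho A (barrier al be K) x <= kappa * barrier al be K x) ->
  lambdastar <= kappa / c.
Proof.
move=> nl c0 fc k0 ext HL; apply: (extremal_le _ ext).
  by rewrite divr_ge0 // ltW.
move=> lambda u l0 sol; rewrite ler_pdivlMr //.
apply: (classical_parameter_le sol l0 _ fc be1 _ _ _ HL).
- exact: nonlinearity_gt0 nl.
- exact: barrier_class_C2.
- by move=> x; exact: barrier_outside.
- by rewrite barrier_center.
Qed.

(** In the transition zone the drift pushes outwards with strength at least
    [A * d * al], which for large [A] absorbs the curvature term and leaves the
    coefficient below [- P / (be - al)]. *)
Lemma barrier_of_negative_drift d P : 0 < d -> 0 < P -> 0 <= A ->
  (forall r, al < r < be -> rho r <= - d) ->
  (N%:R / al + P / (be - al)) / (d * al) <= A ->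
  240 * K <= P * (be - al) ^+ 2 ->
  forall x : 'rV[R]_N, unit_ball x -> Lop rho A (barrier al be K) x <= 1 /\
    Lop rho A (barrier al be K) x <= 2 / K * barrier al be K x.
Proof.
move=> d0 P0 A0 Hd HA HP x x1.
have da0 : 0 < d * al by rewrite mulr_gt0.
have l0 : 0 < be - al by rewrite subr_gt0.
have drift r : al < r < be -> (N%:R - 1) / r + A * rho r * r <= - P / (be - al).
  move=> rab; have /andP[alr rbe] := rab; have r0 : 0 < r by exact: lt_trans alr.
  have H1 : (N%:R - 1) / r <= N%:R / al.
    apply: (@le_trans _ _ (N%:R / r)); first by rewrite ler_pM2r ?invr_gt0 //; lra.
    by rewrite ler_wpM2l // lef_pV2 ?posrE // ltW.
  have H2 : A * rho r * r <= - (A * (d * al)).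
    have : A * (d * al) <= A * (- rho r * r).
      by rewrite ler_wpM2l // ler_pM //; [exact: ltW|exact: ltW|have := Hd _ rab; lra|exact: ltW].
    by rewrite mulNr mulrN mulrA; lra.
  by rewrite ler_pdivrMr // in HA; rewrite mulNr; lra.
have [s [s01 hE LE]] := barrier_Lop_le al0 albe K0 x1 drift.
have [B1 B2] := barrier_drift_le P0 s01.
have Kl0 : 0 < K / (be - al) ^+ 2 by rewrite divr_gt0 // exprn_gt0.
have Kl : K / (be - al) ^+ 2 * (240 / P) <= 1.
  rewrite mulrA ler_pdivrMr // mul1r mulrAC ler_pdivrMr ?exprn_gt0 //.
  by rewrite mulrC.
have S0 : 0 <= 1 - step s.
  rewrite step_compl; have s01' : 0 <= 1 - s <= 1.
    by case/andP: s01 => ? ?; apply/andP; split; lra.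
  by apply: le_trans (step_ge_cube s01'); rewrite exprn_ge0 //; case/andP: s01'.
split; apply: (le_trans LE).
  by apply: le_trans Kl; rewrite ler_pM2l.
rewrite hE (mulrA (2 / K)) divfK ?gt_eqF //.
apply: (@le_trans _ _ (K / (be - al) ^+ 2 * (240 / P * (2 * (1 - step s))))).
  by rewrite ler_pM2l.
by rewrite mulrA ler_piMl // mulr_ge0.
Qed.

(** The barrier varies only where [rho] vanishes, so both constants are
    independent of [A]. *)
Lemma barrier_of_zero_drift (C : R) : C = (be - al) * N%:R / al ->
  (forall r, al < r < be -> rho r = 0) ->
  forall x : 'rV[R]_N, unit_ball x ->
    Lop rho A (barrier al be K) x <= K / (be - al) ^+ 2 * (30 * (2 + C)) /\
    Lop rho A (barrier al be K) x <=
      (30 * (2 + C) / (2 / (4 + C)) ^+ 3) / (be - al) ^+ 2 * barrier al be K x.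
Proof.
move=> CE Hz x x1; have l0 : 0 < be - al by rewrite subr_gt0.
have C0 : 0 <= C by rewrite CE divr_ge0 ?mulr_ge0 // ltW.
have drift r : al < r < be ->
    (N%:R - 1) / r + A * rho r * r <= - (- C) / (be - al).
  move=> rab; have /andP[alr rbe] := rab; have r0 : 0 < r by exact: lt_trans alr.
  rewrite Hz // mulr0 mul0r addr0 opprK CE.
  rewrite (_ : _ / (be - al) = N%:R / al); last by field; rewrite !gt_eqF.
  apply: (@le_trans _ _ (N%:R / r)); first by rewrite ler_pM2r ?invr_gt0 //; lra.
  by rewrite ler_wpM2l // lef_pV2 ?posrE // ltW.
have [s [s01 hE LE]] := barrier_Lop_le al0 albe K0 x1 drift.
have [B1 B2] := barrier_flat_le C0 s01.
have Kl0 : 0 < K / (be - al) ^+ 2 by rewrite divr_gt0 // exprn_gt0.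
split; apply: (le_trans LE); first by rewrite ler_pM2l.
rewrite hE; apply: (@le_trans _ _ (K / (be - al) ^+ 2 *
  (30 * (2 + C) / (2 / (4 + C)) ^+ 3 * (1 - step s)))); first by rewrite ler_pM2l.
set k := 30 * (2 + C) / (2 / (4 + C)) ^+ 3.
by rewrite le_eqVlt; apply/orP; left; apply/eqP; field; rewrite gt_eqF.
Qed.

End Upper.

Section Lower.
Context {R : realType} {n : nat}.
Local Notation N := n.+1.
Variables (rho : R -> R) (A : R).
Hypothesis adm : admissible_rho N rho.

Let q := rho \o clamp 0 1.
Let cq : continuous q. Proof. exact: admissible_continuous adm. Qed.
Let rhoq r : 0 <= r < 1 -> rho r = q r.
Proof. by move=> /andP[r0 r1]; rewrite /q /= clamp_id // r0 ltW. Qed.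

Variable E : R.
Hypothesis E0 : 0 <= E.
Hypothesis fluxE : forall t : R, 0 <= t <= 1 ->
  radial_flux n q A (fun=> 1) t <= E * radial_weight n q A t.

(** The radial solution with right-hand side 1 is a supersolution, and it is
    bounded by [E]. *)
Lemma torsion_le_flux (psi : 'rV[R]_N -> R) : is_torsion rho A psi ->
  0 <= sup_ball psi <= E.
Proof.
move=> tor; have [_ cpsi psi0 _ _] := tor; apply/andP; split.
  apply: le_trans (psi0 0 _) (le_sup_ball cpsi (@unit_ball0 R N)).
  exact: unit_ball_sub (@unit_ball0 R N).
apply: sup_ball_le => x x1.
have c1 : continuous (fun _ : R => 1 : R) by exact: cst_continuous.
pose H := fun x : 'rV[R]_N => radial_solution n q A (fun=> 1) (enorm x).
have r01 (y : 'rV[R]_N) : closed_unit_ball y -> 0 <= enorm y <= 1.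
  by move=> y1; rewrite enorm_ge0.
have HE (y : 'rV[R]_N) : closed_unit_ball y -> 0 <= H y <= E.
  move=> /r01 y1; apply/andP; split.
    have : -1 * H y + 0 * H y <= 0 * E.
      apply: (@radial_comparison R n q A cq (fun=> 1) (fun=> 1)) => // t _; lra.
    by rewrite !mul0r addr0 mulN1r oppr_le0.
  have : 1 * H y + 0 * H y <= 1 * E.
    apply: (@radial_comparison R n q A cq (fun=> 1) (fun=> 1)) => // t _; lra.
  by rewrite mul0r addr0 !mul1r.
have /andP[_ HxE] := HE x (unit_ball_sub x1).
apply: le_trans HxE.
apply: (torsion_le_supersolution tor (H := H)) (unit_ball_sub x1).
- exact: radial_solution_class_C2.
- exact: radial_solution_ball_continuous.
- by move=> y /HE /andP[].
- by move=> y y1; rewrite (radial_solution_Lop A cq rhoq c1).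
Qed.

(** Solvability at [lambda] is obtained by looking for solutions with values
    at most 1/2, a level inside the domain of both kinds of nonlinearity. *)
Lemma extremal_ge_flux (a : \bar R) (f : R -> R) M lambda lambdastar :
  nonlinearity a f -> 0 <= M ->
  (forall s t, 0 <= s <= 1 / 2 -> 0 <= t <= 1 / 2 -> `|f s - f t| <= M * `|s - t|) ->
  0 < lambda -> lambda * f (1 / 2) * E <= 1 / 2 -> lambda * M * E <= 1 / 2 ->
  is_extremal_parameter N rho A a f lambdastar -> lambda <= lambdastar.
Proof.
move=> nl M0 fM l0 lB lM ext; apply: (extremal_ge ext).
have h0 : 0 < (1 / 2 : R) by lra.
have dom t : 0 <= t <= 1 / 2 -> nldom a t.
  move=> /andP[t0 t1]; split => //; apply: le_lt_trans (half_lt_domain nl).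
  by rewrite lee_fin.
have fB t : 0 <= t <= 1 / 2 -> 0 <= f t <= f (1 / 2).
  move=> t01; rewrite (ltW (nonlinearity_gt0 nl (dom _ t01))) /=.
  apply: (nonlinearity_mono nl); [exact: dom|apply: dom|by case/andP: t01].
  by rewrite lexx andbT ltW.
have [u [Cu cu u01 Lu u1]] :=
  radial_classical_solution cq h0 fB M0 fM l0 E0 fluxE lB lM rhoq.
exists u; split => //; first by move=> x _; case/andP: (u01 x).
apply: le_lt_trans (half_lt_domain nl).
apply: ge_ereal_sup => _ [x x1 <-]; rewrite lee_fin.
by have /andP[? ?] := u01 x; rewrite ger0_norm.
Qed.

End Lower.

Section Paraboloid.
Context {R : realType} {n : nat}.
Local Notation N := n.+1.

(** [(1 - r ^+ 2) / (2 * N)] is the torsion function without drift; since it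
    decreases in [r], a nonnegative [rho] makes it a supersolution. *)
Lemma torsion_le_paraboloid (rho : R -> R) (A : R) (psi : 'rV[R]_N -> R) :
  (forall r, 0 <= r <= 1 -> 0 <= rho r) -> 0 <= A ->
  is_torsion rho A psi -> sup_ball psi <= 1 / (2 * N%:R).
Proof.
move=> rho0 A0 tor.
have N0 : (0 : R) < N%:R by rewrite ltr0n.
pose U (r : R) : R := (2 * N%:R)^-1 * (1 - r ^+ 2).
pose V (r : R) : R := - N%:R^-1.
pose Z (r : R) : R := 0.
have dU (r : R) : 0 < r < 1 -> is_derive r 1 U (r * V r).
  move=> _; have D : is_derive r 1 (fun r : R => 1 - r ^+ 2) (- 2 * r).
    by apply: trigger_derive; rewrite /GRing.scale /=; ring.
  apply: (is_derive_eq (is_deriveZ (2 * N%:R)^-1 D)).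
  by rewrite /V /GRing.scale /=; set M := N%:R; field; rewrite gt_eqF.
have dV (r : R) : 0 < r < 1 -> is_derive r 1 V (Z r / r).
  by move=> _; rewrite /Z mul0r; exact: is_derive_cst.
have cU (r : R) : {for r, continuous U}.
  have D : is_derive r 1 (fun r : R => 1 - r ^+ 2) (- 2 * r).
    by apply: trigger_derive; rewrite /GRing.scale /=; ring.
  exact: is_derive_continuous (is_deriveZ (2 * N%:R)^-1 D).
have cV (r : R) : 0 <= r < 1 -> {for r, continuous V} by move=> _; exact: cst_continuous.
have cZ (r : R) : 0 <= r < 1 -> {for r, continuous Z} by move=> _; exact: cst_continuous.
have Z0 : Z 0 = 0 by [].
pose H := fun x : 'rV[R]_N => U (enorm x).
apply: sup_ball_le => x x1; apply: (@le_trans _ _ (H x)).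
  apply: (torsion_le_supersolution tor (H := H)) (unit_ball_sub x1).
  - exact: radial_class_C2 dU dV (cU 0) cV cZ Z0.
  - apply: continuous_subspaceT => y.
    by apply: (@continuous_comp _ _ _ (@enorm R N)); [exact: enorm_continuous|exact: cU].
  - move=> y /= y1; rewrite /H /U mulr_ge0 ?invr_ge0 ?mulr_ge0 ?(ltW N0) // subr_ge0.
    by rewrite expr_le1 ?enorm_ge0.
  - move=> y y1; rewrite (radial_Lop dU dV (cU 0) cV Z0) // /V /Z addr0.
    rewrite mulrN divff ?gt_eqF // opprK lerDl mulrN mulrN opprK.
    apply: mulr_ge0.
      by apply: mulr_ge0 => //; apply: rho0; rewrite enorm_ge0 ltW.
    by apply: mulr_ge0; [exact: sqr_ge0|rewrite invr_ge0 ltW].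
rewrite /H /U div1r ler_piMr ?invr_ge0 ?mulr_ge0 ?(ltW N0) //.
by rewrite lerBlDr lerDl sqr_ge0.
Qed.

End Paraboloid.

(** * Behaviour as the drift grows *)

Section Limits.
Context {R : realType}.
Implicit Types (F : R -> R).

Lemma cvg_pinfty_of_ge F :
  (forall K, 0 < K -> exists2 A0, 0 <= A0 & forall A, A0 <= A -> K <= F A) ->
  F A @[A --> +oo] --> +oo.
Proof.
move=> H; apply/cvgryPge => K.
have [|A0 _ HA] := H (Num.max K 1); first by rewrite lt_max ltr01 orbT.
exists A0; split; first exact: num_real.
by move=> A /ltW /HA; rewrite ge_max => /andP[].
Qed.

Lemma cvg_pinfty_zero F :
  (forall e, 0 < e -> exists2 A0, 0 <= A0 & forall A, A0 <= A -> 0 <= F A <= e) ->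
  F A @[A --> +oo] --> (0 : R).
Proof.
move=> H; apply/cvgrPdist_le => e e0.
have [A0 _ HA] := H e e0; exists A0; split; first exact: num_real.
by move=> A /ltW /HA /andP[F0 Fe]; rewrite sub0r normrN ger0_norm.
Qed.

End Limits.

Section Asymptotics.
Context {R : realType} {n : nat}.
Local Notation N := n.+1.
Variable rho : R -> R.
Hypothesis adm : admissible_rho N rho.

Section NegativeSomewhere.
Hypothesis rho_neg : exists x0 : R, 0 <= x0 <= 1 /\ rho x0 < 0.

(** The zone between [al] and [be] does not depend on the height [K]; a higher
    barrier only requires a stronger drift. *)
Lemma barrier_at_large_drift : exists al be : R, [/\ 0 < al, al < be, be < 1 &
  forall K, 0 < K -> exists2 A0, 0 <= A0 & forall A, A0 <= A ->
    forall x : 'rV[R]_N, unit_ball x -> Lop rho A (barrier al be K) x <= 1 /\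
      Lop rho A (barrier al be K) x <= 2 / K * barrier al be K x].
Proof.
have [al [be [d [al0 albe be1 d0 Hd]]]] := negative_on_subinterval adm rho_neg.
exists al, be; split => // K K0.
have l0 : 0 < be - al by rewrite subr_gt0.
have [P P0 PE] : exists2 P, 0 < P & 240 * K = P * (be - al) ^+ 2.
  exists (240 * K / (be - al) ^+ 2); last by rewrite divfK // gt_eqF // exprn_gt0.
  apply: divr_gt0; last exact: exprn_gt0.
  by apply: mulr_gt0; [rewrite ltr0n|exact: K0].
have B0 : 0 <= (N%:R / al + P / (be - al)) / (d * al).
  by rewrite divr_ge0 ?addr_ge0 ?divr_ge0 ?mulr_ge0 // ltW.
exists ((N%:R / al + P / (be - al)) / (d * al)) => // A HA x x1.
apply: (barrier_of_negative_drift al0 albe K0 d0 P0 _ Hd HA _ x1).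
  exact: le_trans HA.
by rewrite PE.
Qed.

Lemma torsion_diverges (psi : R -> 'rV[R]_N -> R) :
  (forall A, 0 <= A -> is_torsion rho A (psi A)) ->
  sup_ball (psi A) @[A --> +oo] --> +oo.
Proof.
move=> tor; have [al [be [al0 albe be1 H]]] := barrier_at_large_drift.
apply: cvg_pinfty_of_ge => K K0; have [A0 A00 HA] := H K K0.
exists A0 => // A AA0; apply: (torsion_ge_of_barrier al0 albe be1 K0 (tor A _)).
  exact: le_trans AA0.
by move=> x /(HA A AA0) [].
Qed.

Lemma extremal_vanishes (a : \bar R) (f : R -> R) (lambdastar : R -> R) :
  nonlinearity a f ->
  (forall A, 0 <= A -> is_extremal_parameter N rho A a f (lambdastar A)) ->
  lambdastar A @[A --> +oo] --> (0 : R).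
Proof.
move=> nl ext; have [al [be [al0 albe be1 H]]] := barrier_at_large_drift.
have [c c0 fc] := nonlinearity_linear_bound nl.
apply: cvg_pinfty_zero => e e0.
have K0 : 0 < 2 / (e * c) by rewrite divr_gt0 // mulr_gt0.
have [A0 A00 HA] := H _ K0; exists A0 => // A AA0.
have A1 : 0 <= A by exact: le_trans AA0.
have [l0 _ _] := ext A A1; rewrite ltW //=.
have k0 : 0 <= 2 / (2 / (e * c)) by rewrite divr_ge0 // ltW.
have := extremal_le_of_barrier al0 albe be1 K0 nl c0 fc k0 (ext A A1)
  (fun x x1 => (HA A AA0 x x1).2).
suff -> : 2 / (2 / (e * c)) / c = e by [].
by field; rewrite !gt_eqF.
Qed.

End NegativeSomewhere.

Section NonnegativeDrift.
Hypothesis rho0 : forall r, 0 <= r <= 1 -> 0 <= rho r.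

Section StrictDrift.
Hypothesis rhoI : forall I : set R, nondegenerate_subinterval I ->
  ~ (forall r, I r -> rho r = 0).

Lemma torsion_vanishes (psi : R -> 'rV[R]_N -> R) :
  (forall A, 0 <= A -> is_torsion rho A (psi A)) ->
  sup_ball (psi A) @[A --> +oo] --> (0 : R).
Proof.
move=> tor; apply: cvg_pinfty_zero => e e0.
have [A0 A00 HA] := flux_small_of_large_drift adm rho0 rhoI n e0.
exists A0 => // A AA0.
apply: (torsion_le_flux adm (ltW e0) (HA A AA0)); apply: tor.
exact: le_trans AA0.
Qed.

(** By [flux_small_of_large_drift] the constant [E] can be made as small as
    wished, and the two smallness conditions of the contraction argument hold
    at any given [lambda]. *)
Lemma extremal_diverges (a : \bar R) (f : R -> R) (lambdastar : R -> R) :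
  nonlinearity a f ->
  (forall A, 0 <= A -> is_extremal_parameter N rho A a f (lambdastar A)) ->
  lambdastar A @[A --> +oo] --> +oo.
Proof.
move=> nl ext; have [M M0 fM] := nonlinearity_lipschitz nl.
apply: cvg_pinfty_of_ge => X X0.
have fh : 0 < f (1 / 2).
  apply: (nonlinearity_gt0 nl); split; first by lra.
  exact: half_lt_domain nl.
have den : 0 < 2 * (X * (f (1 / 2) + M)) by rewrite !mulr_gt0 // ltr_wpDr.
have e0 : 0 < (2 * (X * (f (1 / 2) + M)))^-1 by rewrite invr_gt0.
have [A0 A00 HA] := flux_small_of_large_drift adm rho0 rhoI n e0.
exists A0 => // A AA0; have A1 : 0 <= A by exact: le_trans AA0.
apply: (extremal_ge_flux adm (ltW e0) (HA A AA0) nl M0 fM X0 _ _ (ext A A1)).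
  by rewrite ler_pdivrMr // div1r mulKf // ler_pM2l // lerDl.
by rewrite ler_pdivrMr // div1r mulKf // ler_pM2l // lerDr -div1r (ltW fh).
Qed.

End StrictDrift.

Section VanishingDrift.
Hypothesis rho_zero : exists I : set R,
  nondegenerate_subinterval I /\ forall r, I r -> rho r = 0.

Lemma torsion_ge_constant : exists2 C : R, 0 < C &
  forall A (psi : 'rV[R]_N -> R), is_torsion rho A psi -> C <= sup_ball psi.
Proof.
have [al [be [al0 albe be1 Hz]]] := zero_on_subinterval rho_zero.
have l0 : 0 < be - al by rewrite subr_gt0.
pose C := (be - al) * N%:R / al.
have C0 : 0 <= C by rewrite divr_ge0 ?mulr_ge0 // ltW.
have D0 : 0 < 30 * (2 + C) by rewrite mulr_gt0 ?ltr0n //; lra.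
pose K := (be - al) ^+ 2 / (30 * (2 + C)).
have K0 : 0 < K by rewrite divr_gt0 // exprn_gt0.
exists K => // A psi tor; apply: (torsion_ge_of_barrier al0 albe be1 K0 tor).
move=> x x1.
have [H _] := barrier_of_zero_drift A al0 albe K0 (erefl C) Hz x1.
apply: (le_trans H); rewrite le_eqVlt; apply/orP; left; apply/eqP.
rewrite /K; set D := 30 * (2 + C) in D0 *.
by field; rewrite !gt_eqF.
Qed.

Lemma extremal_le_constant (a : \bar R) (f : R -> R) : nonlinearity a f ->
  exists2 D : R, 0 < D & forall A lambdastar,
    is_extremal_parameter N rho A a f lambdastar -> lambdastar <= D.
Proof.
move=> nl; have [al [be [al0 albe be1 Hz]]] := zero_on_subinterval rho_zero.
have [c c0 fc] := nonlinearity_linear_bound nl.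
have l0 : 0 < be - al by rewrite subr_gt0.
pose C := (be - al) * N%:R / al.
have C0 : 0 <= C by rewrite divr_ge0 ?mulr_ge0 // ltW.
pose k := 30 * (2 + C) / (2 / (4 + C)) ^+ 3 / (be - al) ^+ 2.
have k0 : 0 < k.
  have D0 : 0 < 30 * (2 + C) by rewrite mulr_gt0 ?ltr0n //; lra.
  apply: divr_gt0; last exact: exprn_gt0.
  by apply: divr_gt0 => //; apply: exprn_gt0; rewrite divr_gt0 //; lra.
exists (k / c) => [|A lambdastar ext]; first by rewrite divr_gt0.
apply: (extremal_le_of_barrier al0 albe be1 ltr01 nl c0 fc (ltW k0) ext) => x x1.
exact: (barrier_of_zero_drift A al0 albe ltr01 (erefl C) Hz x1).2.
Qed.

End VanishingDrift.
End NonnegativeDrift.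
End Asymptotics.

(** For nonnegative drift the constant [E = 1] is always admissible, so the
    contraction argument works at a [lambda] that depends on [f] alone. *)
Lemma extremal_ge_constant (R : realType) (n : nat) (a : \bar R) (f : R -> R) :
  nonlinearity a f -> exists2 D : R, 0 < D &
    forall (rho : R -> R) A lambdastar, admissible_rho n.+1 rho ->
      (forall r, 0 <= r <= 1 -> 0 <= rho r) -> 0 <= A ->
      is_extremal_parameter n.+1 rho A a f lambdastar -> D <= lambdastar.
Proof.
move=> nl; have [M M0 fM] := nonlinearity_lipschitz nl.
have fh : 0 < f (1 / 2).
  apply: (nonlinearity_gt0 nl); split; first by lra.
  exact: half_lt_domain nl.
have den : 0 < 2 * (f (1 / 2) + M) by rewrite mulr_gt0 // ltr_wpDr.
exists (2 * (f (1 / 2) + M))^-1; first by rewrite invr_gt0.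
move=> rho A lambdastar adm rho0 A0 ext.
have D0 : 0 < (2 * (f (1 / 2) + M))^-1 by rewrite invr_gt0.
have q0 (r : R) : 0 <= r <= 1 -> 0 <= (rho \o clamp 0 1) r.
  by move=> r01; rewrite /= clamp_id // rho0.
have flux1 (t : R) : 0 <= t <= 1 -> radial_flux n (rho \o clamp 0 1) A (fun=> 1) t <=
    1 * radial_weight n (rho \o clamp 0 1) A t.
  move=> t01; have cq := admissible_continuous adm.
  apply: (le_trans (radial_flux_le n cq q0 A0 t01)).
  by rewrite ler_wpM2r ?radial_weight_ge0 //; case/andP: t01.
apply: (extremal_ge_flux adm ler01 flux1 nl M0 fM D0 _ _ ext).
  by rewrite mulr1 mulrC ler_pdivrMr // mulrA div1r mulVf // mul1r lerDl.
by rewrite mulr1 mulrC ler_pdivrMr // mulrA div1r mulVf // mul1r lerDr -div1r (ltW fh).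
Qed.

Theorem theorem1p2 (R : realType) (N : nat) (hN : (2 <= N)%N) :
  (* (i) *)
  (forall rho : R -> R, admissible_rho N rho ->
    (exists x0 : R, 0 <= x0 <= 1 /\ rho x0 < 0) ->
    (forall psi : R -> 'rV[R]_N -> R,
      (forall A, 0 <= A -> is_torsion rho A (psi A)) ->
      sup_ball (psi A) @[A --> +oo] --> +oo) /\
    (forall (a : \bar R) (f : R -> R), nonlinearity a f ->
      forall lambdastar : R -> R,
      (forall A, 0 <= A -> is_extremal_parameter N rho A a f (lambdastar A)) ->
      lambdastar A @[A --> +oo] --> (0 : R)))
  /\
  (* (ii) *)
  (forall rho : R -> R, admissible_rho N rho ->
    (forall r, 0 <= r <= 1 -> 0 <= rho r) ->
    (forall I : set R, nondegenerate_subinterval I ->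
      ~ (forall r, I r -> rho r = 0)) ->
    (forall psi : R -> 'rV[R]_N -> R,
      (forall A, 0 <= A -> is_torsion rho A (psi A)) ->
      sup_ball (psi A) @[A --> +oo] --> (0 : R)) /\
    (forall (a : \bar R) (f : R -> R), nonlinearity a f ->
      forall lambdastar : R -> R,
      (forall A, 0 <= A -> is_extremal_parameter N rho A a f (lambdastar A)) ->
      lambdastar A @[A --> +oo] --> +oo))
  /\
  (* (iii) *)
  ((forall rho : R -> R, admissible_rho N rho ->
    (forall r, 0 <= r <= 1 -> 0 <= rho r) ->
    (exists I : set R, nondegenerate_subinterval I /\
      forall r, I r -> rho r = 0) ->
    exists C : R, 0 < C /\
      forall psi : R -> 'rV[R]_N -> R,
      (forall A, 0 <= A -> is_torsion rho A (psi A)) ->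
      forall A, 0 <= A -> C <= sup_ball (psi A) <= 1 / (2 * N%:R)) /\
   (forall (a : \bar R) (f : R -> R), nonlinearity a f ->
    exists D : R, 0 < D /\
      forall rho : R -> R, admissible_rho N rho ->
      (forall r, 0 <= r <= 1 -> 0 <= rho r) ->
      (exists I : set R, nondegenerate_subinterval I /\
        forall r, I r -> rho r = 0) ->
      exists Dt : R, 0 < Dt /\
        forall lambdastar : R -> R,
        (forall A, 0 <= A ->
          is_extremal_parameter N rho A a f (lambdastar A)) ->
        forall A, 0 <= A -> D <= lambdastar A <= Dt)).
Proof.
case: N hN => [//|n] _; split; [|split; [|split]].
- move=> rho adm neg; split => [psi|a f nl lambdastar].
    exact: torsion_diverges.
  exact: extremal_vanishes.
- move=> rho adm rho0 rhoI; split => [psi|a f nl lambdastar].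
    exact: torsion_vanishes.
  exact: extremal_diverges.
- move=> rho adm rho0 rhoz; have [C C0 HC] := @torsion_ge_constant R n rho rhoz.
  exists C; split => // psi tor A A0; rewrite (HC A _ (tor A A0)) /=.
  exact: torsion_le_paraboloid rho0 A0 (tor A A0).
- move=> a f nl; have [D D0 HD] := extremal_ge_constant n nl.
  exists D; split => // rho adm rho0 rhoz.
  have [Dt Dt0 HDt] := @extremal_le_constant R n rho rhoz a f nl.
  exists Dt; split => // lambdastar ext A A0.
  by rewrite (HD rho A _ adm rho0 A0 (ext A A0)) (HDt A _ (ext A A0)).
Qed.
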